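(* Let $a,b\in\mathbb{C}$ with $a\neq0$, $\Re(b)>0$, $\Re(b+a)>0$, $\Re(b-a)>0$, $\frac32\pm\frac{a}{2b}\notin\mathbb{Z}_0^-$ and $\frac ab\notin\{\pm1,\pm3,\pm5,\dots\}$. Then $$ {}_3F_2\!\left(\begin{matrix}1,\ \frac12-\frac{a}{2b},\ \frac12+\frac{a}{2b}\\ \frac32-\frac{a}{2b},\ \frac32+\frac{a}{2b}\end{matrix};\,-1\right) =\frac{b^2-a^2}{2ab}\left[\frac\pi2\sec\!\Big(\frac{\pi a}{2b}\Big)-\beta\!\Big(\frac{a+b}{2b}\Big)\right] =\frac{b^2-a^2}{8ab}\left[\Psi\!\Big(\frac{3b-a}{4b}\Big)-\Psi\!\Big(\frac{b-a}{4b}\Big)-\Psi\!\Big(\frac{3b+a}{4b}\Big)+\Psi\!\Big(\frac{b+a}{4b}\Big)\right]. $$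
   Context: $\mathbb{Z}_0^-=\{0,-1,-2,\dots\}$. The Pochhammer symbol is $(\lambda)_0=1$, $(\lambda)_n=\lambda(\lambda+1)\cdots(\lambda+n-1)$ for $n\ge1$. The generalized hypergeometric series is ${}_pF_q\!\left(\begin{matrix}\alpha_1,\dots,\alpha_p\\ \beta_1,\dots,\beta_q\end{matrix};z\right)=\sum_{n=0}^\infty\frac{(\alpha_1)_n\cdots(\alpha_p)_n}{(\beta_1)_n\cdots(\beta_q)_n}\frac{z^n}{n!}$ (with no $\beta_j\in\mathbb{Z}_0^-$). The (lower case) beta function of one variable is $\beta(x)=\sum_{k=0}^\infty\frac{(-1)^k}{k+x}$ for $x\in\mathbb{C}\setminus\mathbb{Z}_0^-$. $\Psi=\Gamma'/\Gamma$ is the digamma function. *)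

(* Defs.v *)
From Stdlib Require Import Reals Lra ClassicalEpsilon List Factorial.
Open Scope R_scope.

Definition Cplx : Type := (R * R)%type.
Definition RtoC (x : R) : Cplx := (x, 0).
Definition Re (z : Cplx) : R := fst z.
Definition Im (z : Cplx) : R := snd z.
Definition Czero : Cplx := RtoC 0.
Definition Cone : Cplx := RtoC 1.
Definition Ci : Cplx := (0, 1).
Definition Cadd (z w : Cplx) : Cplx := (fst z + fst w, snd z + snd w).
Definition Copp (z : Cplx) : Cplx := (- fst z, - snd z).
Definition Csub (z w : Cplx) : Cplx := Cadd z (Copp w).
Definition Cmul (z w : Cplx) : Cplx :=
  (fst z * fst w - snd z * snd w, fst z * snd w + snd z * fst w).
Definition Cinv (z : Cplx) : Cplx :=
  (fst z / (fst z ^ 2 + snd z ^ 2), - snd z / (fst z ^ 2 + snd z ^ 2)).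
Definition Cdiv (z w : Cplx) : Cplx := Cmul z (Cinv w).
Definition Cnorm (z : Cplx) : R := sqrt (fst z ^ 2 + snd z ^ 2).
Fixpoint Cpow (z : Cplx) (n : nat) : Cplx :=
  match n with O => Cone | S m => Cmul z (Cpow z m) end.
Definition Cexp (z : Cplx) : Cplx := (exp (fst z) * cos (snd z), exp (fst z) * sin (snd z)).
Definition Ccos (z : Cplx) : Cplx :=
  Cdiv (Cadd (Cexp (Cmul Ci z)) (Cexp (Copp (Cmul Ci z)))) (RtoC 2).
Definition Csec (z : Cplx) : Cplx := Cinv (Ccos z).
Definition Cnatpow (n : nat) (z : Cplx) : Cplx := Cexp (Cmul z (RtoC (ln (INR n)))).

Definition Cseq_cv (u : nat -> Cplx) (l : Cplx) : Prop :=
  forall eps, eps > 0 -> exists N : nat, forall n, (n >= N)%nat -> Cnorm (Csub (u n) l) < eps.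
Definition Clim_seq (u : nat -> Cplx) : Cplx := epsilon (inhabits Czero) (fun l => Cseq_cv u l).

Fixpoint Cpartial (f : nat -> Cplx) (n : nat) : Cplx :=
  match n with O => Czero | S m => Cadd (Cpartial f m) (f m) end.
Definition Csum (f : nat -> Cplx) : Cplx := Clim_seq (Cpartial f).

Fixpoint poch (l : Cplx) (n : nat) : Cplx :=
  match n with O => Cone | S m => Cmul (poch l m) (Cadd l (RtoC (INR m))) end.
Definition Cprod_list (l : list Cplx) : Cplx := fold_right Cmul Cone l.
Definition hyp_term (alphas betas : list Cplx) (z : Cplx) (n : nat) : Cplx :=
  Cdiv (Cmul (Cdiv (Cprod_list (map (fun a => poch a n) alphas))
                   (Cprod_list (map (fun b => poch b n) betas)))
             (Cpow z n))
       (RtoC (INR (fact n))).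
Definition pFq (alphas betas : list Cplx) (z : Cplx) : Cplx := Csum (hyp_term alphas betas z).

Definition in_Z0minus (z : Cplx) : Prop := exists n : nat, z = RtoC (- INR n).

Definition beta_fun (x : Cplx) : Cplx :=
  Csum (fun k => Cdiv (RtoC ((-1) ^ k)) (Cadd (RtoC (INR k)) x)).

(** * Gamma (Gauss/Euler limit formula) and digamma Psi = Gamma'/Gamma *)
Definition CGamma (z : Cplx) : Cplx :=
  Clim_seq (fun n => Cdiv (Cmul (RtoC (INR (fact n))) (Cnatpow n z))
                          (Cprod_list (map (fun k => Cadd z (RtoC (INR k))) (seq 0 (S n))))).
Definition Cderiv_at (f : Cplx -> Cplx) (z L : Cplx) : Prop :=
  forall eps, eps > 0 -> exists delta, delta > 0 /\
    forall h, 0 < Cnorm h < delta ->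
      Cnorm (Csub (Cdiv (Csub (f (Cadd z h)) (f z)) h) L) < eps.
Definition Cderiv (f : Cplx -> Cplx) (z : Cplx) : Cplx := epsilon (inhabits Czero) (fun L => Cderiv_at f z L).
Definition Psi (z : Cplx) : Cplx := Cdiv (Cderiv CGamma z) (CGamma z).

(* Main.v *)
From Stdlib Require Import Reals Lra Lia List Factorial ClassicalEpsilon.
Require Import Defs.
From Coquelicot Require Import Coquelicot.
Import ListNotations.
Open Scope R_scope.

(** With [c = a/(2b)], [x = 1/2 + c] and [y = 1/2 - c], partial fractions turn the hypergeometric
    series into [y x / (x - y) (beta y - beta x)], so the two equalities amount to
    [beta x + beta y = PI / cos (PI c)] and [2 beta x = Psi ((x+1)/2) - Psi (x/2)].

    For the second one, [Gamma (z+h) / Gamma z] is an infinite product of factors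
    [1 + h d_k + O(|h|^2/k^2)], where [d_k = ln (k/(k-1)) - 1/(z+k)] is summable; hence
    [Psi z = sum d_k], and pairing the terms of the beta series gives a difference of two such sums.

    For the first one, the [n]-th partial sum of [cos (PI c) (beta x + beta y) / 2] is the integral over
    [[0, PI/2]] of [cos (2 c t)] against the Dirichlet kernel [sin (2 n t) / sin t]. Its difference with the
    case [c = 0], Leibniz's series for [PI], is [O(1/n)] by one integration by parts, which is carried out
    here with the mean value theorem on an explicit antiderivative. *)

(** * Limits of complex sequences *)

(** Limits and derivatives in the definitions are chosen by [epsilon], so a value can be computed
    only after its existence is proved. For Gamma, convergence is known explicitly only at 1, where
    Gauss's expression is [n / (n + 1)]; the infinite product carries it from 1 to any [z], and read
    backwards from [z] to 1 it shows that Gamma does not vanish. Differentiating Gamma means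
    exchanging the limit in [n] with the limit [h -> 0]. No theory of holomorphic functions is used:
    the finite products differ from their linear part by at most a constant times [|h|^2], uniformly
    in [n], and such a bound passes to the limit. For the secant, subtracting the case [c = 0] is
    what makes integration by parts possible: [cos (2 c t) - 1] vanishes to second order at 0, so
    its quotient by [sin t] has a bounded derivative. As [c] is complex and the mean value theorem
    is real, real and imaginary parts are estimated separately. *)

Lemma Cmod_le_abs (z : C) : Cmod z <= Rabs (fst z) + Rabs (snd z).
Proof.
destruct z as [x y]; unfold Cmod; simpl.
rewrite <- (sqrt_Rsqr (Rabs x + Rabs y)) by (pose proof (Rabs_pos x); pose proof (Rabs_pos y); lra).
apply sqrt_le_1_alt; unfold Rsqr.
pose proof (Rabs_pos x); pose proof (Rabs_pos y).
pose proof (pow2_abs x); pose proof (pow2_abs y); nra.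
Qed.

Lemma abs_fst_le (z : C) : Rabs (fst z) <= Cmod z.
Proof. eapply Rle_trans; [apply Rmax_l | apply Rmax_Cmod]. Qed.

Lemma abs_snd_le (z : C) : Rabs (snd z) <= Cmod z.
Proof. eapply Rle_trans; [apply Rmax_r | apply Rmax_Cmod]. Qed.

Lemma Cseq_cv_parts (u : nat -> C) (l : C) :
  Cseq_cv u l <->
  is_lim_seq (fun n => fst (u n)) (fst l) /\ is_lim_seq (fun n => snd (u n)) (snd l).
Proof.
split.
- intros H; split; apply is_lim_seq_spec; intros [eps Heps]; destruct (H eps Heps) as [N HN];
    exists N; intros n Hn; specialize (HN n Hn); simpl;
    change (Cmod (u n - l)%C < eps) in HN.
  + eapply Rle_lt_trans; [apply (abs_fst_le (u n - l)%C) | exact HN].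
  + eapply Rle_lt_trans; [apply (abs_snd_le (u n - l)%C) | exact HN].
- intros [H1 H2] eps Heps.
  apply is_lim_seq_spec in H1; apply is_lim_seq_spec in H2.
  destruct (H1 (pos_div_2 (mkposreal eps Heps))) as [N1 HN1].
  destruct (H2 (pos_div_2 (mkposreal eps Heps))) as [N2 HN2].
  exists (max N1 N2); intros n Hn.
  specialize (HN1 n ltac:(lia)); specialize (HN2 n ltac:(lia)); simpl in HN1, HN2.
  change (Cmod (u n - l)%C < eps).
  eapply Rle_lt_trans; [apply Cmod_le_abs |].
  change (fst (u n - l)%C) with (fst (u n) - fst l).
  change (snd (u n - l)%C) with (snd (u n) - snd l). lra.
Qed.

Lemma Cseq_cv_unique (u : nat -> C) (l l' : C) : Cseq_cv u l -> Cseq_cv u l' -> l = l'.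
Proof.
rewrite !Cseq_cv_parts; intros [H1 H2] [H3 H4].
apply is_lim_seq_unique in H1, H2, H3, H4.
apply injective_projections; congruence.
Qed.

Lemma Clim_seq_eq (u : nat -> C) (l : C) : Cseq_cv u l -> Clim_seq u = l.
Proof.
intros H; unfold Clim_seq.
apply (Cseq_cv_unique u); [| exact H].
apply (epsilon_spec (inhabits Czero) (fun l => Cseq_cv u l)); exists l; exact H.
Qed.

Lemma Cseq_cv_ext (u v : nat -> C) (l : C) : (forall n, u n = v n) -> Cseq_cv u l -> Cseq_cv v l.
Proof. intros E H eps Heps; destruct (H eps Heps) as [N HN]; exists N; intros n Hn; rewrite <- E; auto. Qed.

Lemma Cseq_cv_const (l : C) : Cseq_cv (fun _ => l) l.
Proof. apply Cseq_cv_parts; split; apply is_lim_seq_const. Qed.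

Lemma Cseq_cv_plus (u v : nat -> C) (l m : C) :
  Cseq_cv u l -> Cseq_cv v m -> Cseq_cv (fun n => u n + v n)%C (l + m)%C.
Proof.
rewrite !Cseq_cv_parts; intros [H1 H2] [H3 H4]; split; simpl; now apply is_lim_seq_plus'.
Qed.

Lemma Cseq_cv_mult (u v : nat -> C) (l m : C) :
  Cseq_cv u l -> Cseq_cv v m -> Cseq_cv (fun n => u n * v n)%C (l * m)%C.
Proof.
rewrite !Cseq_cv_parts; intros [H1 H2] [H3 H4]; split; simpl.
- apply is_lim_seq_minus'; now apply is_lim_seq_mult'.
- apply is_lim_seq_plus'; now apply is_lim_seq_mult'.
Qed.

Lemma Cseq_cv_scal (a : C) (u : nat -> C) (l : C) :
  Cseq_cv u l -> Cseq_cv (fun n => a * u n)%C (a * l)%C.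
Proof. intros H; apply Cseq_cv_mult; [apply Cseq_cv_const | exact H]. Qed.

Lemma Cseq_cv_minus (u v : nat -> C) (l m : C) :
  Cseq_cv u l -> Cseq_cv v m -> Cseq_cv (fun n => u n - v n)%C (l - m)%C.
Proof.
intros H1 H2; apply Cseq_cv_plus; [exact H1 |].
replace (- m)%C with (RtoC (-1) * m)%C by ring.
apply (Cseq_cv_ext (fun n => RtoC (-1) * v n)%C); [intros n; ring |].
now apply Cseq_cv_scal.
Qed.

Lemma Cseq_cv_RtoC (u : nat -> R) (l : R) : is_lim_seq u l -> Cseq_cv (fun n => RtoC (u n)) (RtoC l).
Proof. intros H; apply Cseq_cv_parts; split; [exact H | apply is_lim_seq_const]. Qed.

Lemma Cseq_cv_comp (u : nat -> C) (l : C) (phi : nat -> nat) :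
  (forall n, (n <= phi n)%nat) -> Cseq_cv u l -> Cseq_cv (fun n => u (phi n)) l.
Proof.
intros Hphi H eps Heps; destruct (H eps Heps) as [N HN]; exists N; intros n Hn.
apply HN; specialize (Hphi n); lia.
Qed.

Lemma Cseq_cv_of_shift (u : nat -> C) (l : C) : Cseq_cv (fun n => u (S n)) l -> Cseq_cv u l.
Proof.
intros H eps Heps; destruct (H eps Heps) as [N HN]; exists (S N); intros [|n] Hn; [lia |].
apply HN; lia.
Qed.

Lemma Cseq_cv_squeeze (u : nat -> C) (l : C) (r : nat -> R) :
  (forall n, Cmod (u n - l)%C <= r n) -> is_lim_seq r 0 -> Cseq_cv u l.
Proof.
intros H Hr eps Heps; apply is_lim_seq_spec in Hr.
destruct (Hr (mkposreal eps Heps)) as [N HN]; exists N; intros n Hn.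
eapply Rle_lt_trans; [apply H |]; specialize (HN n Hn); simpl in HN.
apply Rabs_def2 in HN; lra.
Qed.

Lemma Cseq_cv_Cmod_le (u : nat -> C) (l : C) (M : R) :
  (forall n, Cmod (u n) <= M) -> Cseq_cv u l -> Cmod l <= M.
Proof.
intros HM H; apply le_epsilon; intros eps Heps.
destruct (H eps Heps) as [N HN]; specialize (HN N (Nat.le_refl _)); specialize (HM N).
change (Cmod (u N - l)%C < eps) in HN.
replace l with (u N + - (u N - l))%C by ring.
eapply Rle_trans; [apply Cmod_triangle |]; rewrite Cmod_opp; lra.
Qed.

(** Meant for alternating series: their terms are summed in pairs, which reaches only the even
    partial sums, and terms tending to 0 carry the limit over to the odd ones. *)
Lemma Cseq_cv_even (u : nat -> C) (l : C) :
  Cseq_cv (fun n => u (2 * n)%nat) l -> Cseq_cv (fun n => u (S n) - u n)%C (RtoC 0) -> Cseq_cv u l.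
Proof.
intros H D eps Heps.
destruct (H (eps / 2) ltac:(lra)) as [N1 HN1]; destruct (D (eps / 2) ltac:(lra)) as [N2 HN2].
exists (2 * N1 + N2 + 1)%nat; intros n Hn.
change (Cmod (u n - l)%C < eps).
destruct (Nat.Even_or_Odd n) as [[k Hk] | [k Hk]].
- specialize (HN1 k ltac:(lia)); change (Cmod (u (2 * k)%nat - l)%C < eps / 2) in HN1.
  rewrite Hk; lra.
- specialize (HN1 k ltac:(lia)); change (Cmod (u (2 * k)%nat - l)%C < eps / 2) in HN1.
  specialize (HN2 (2 * k)%nat ltac:(lia)).
  change (Cmod ((u (S (2 * k)) - u (2 * k)%nat) - 0)%C < eps / 2) in HN2.
  replace n with (S (2 * k)) by lia.
  replace (u (S (2 * k)) - l)%C
    with ((u (S (2 * k)) - u (2 * k)%nat - 0) + (u (2 * k)%nat - l))%C by ring.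
  eapply Rle_lt_trans; [apply Cmod_triangle | lra].
Qed.

(* A majorant of order [1/k^2] whose partial sums telescope and stay below [1]. *)
Definition gap (k : nat) : R := / (INR k + 1) - / (INR k + 2).

Lemma gap_eq (k : nat) : gap k = / ((INR k + 1) * (INR k + 2)).
Proof. unfold gap; pose proof (pos_INR k); field; lra. Qed.

Lemma gap_pos (k : nat) : 0 < gap k.
Proof. rewrite gap_eq; pose proof (pos_INR k); apply Rinv_0_lt_compat; nra. Qed.

(** The bounds on the increments telescope, so that [u m] stays within [M / (n + 1)] of [u n] for
    all [m >= n]; both coordinates are then Cauchy. *)
Lemma Cseq_cv_gap (u : nat -> C) (M : R) :
  (forall n, Cmod (u (S n) - u n)%C <= M * gap n) -> exists l : C, Cseq_cv u l.
Proof.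
intros H.
assert (HM : 0 <= M).
{ pose proof (H 0%nat); pose proof (gap_pos 0); pose proof (Cmod_ge_0 (u 1%nat - u 0%nat)%C).
  destruct (Rle_or_lt 0 M); nra. }
assert (T : forall n m, Cmod (u (n + m)%nat - u n)%C <= M * (/ (INR n + 1) - / (INR (n + m) + 1))).
{ intros n m; induction m as [|m IH].
  - rewrite Nat.add_0_r; replace (u n - u n)%C with (RtoC 0) by ring; rewrite Cmod_0; lra.
  - rewrite Nat.add_succ_r.
    replace (u (S (n + m)) - u n)%C
      with ((u (S (n + m)) - u (n + m)%nat) + (u (n + m)%nat - u n))%C by ring.
    eapply Rle_trans; [apply Cmod_triangle |].
    specialize (H (n + m)%nat); unfold gap in H; rewrite S_INR.
    replace (INR (n + m) + 1 + 1) with (INR (n + m) + 2) by ring; lra. }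
assert (B : forall n m, (n <= m)%nat -> Cmod (u m - u n)%C <= M * / (INR n + 1)).
{ intros n m Hnm; specialize (T n (m - n)%nat); rewrite (Nat.add_comm n (m - n)), Nat.sub_add in T by easy.
  assert (0 < / (INR m + 1)) by (apply Rinv_0_lt_compat; pose proof (pos_INR m); lra); nra. }
assert (Hlim : is_lim_seq (fun n => M * / (INR n + 1)) 0).
{ replace (Finite 0) with (Rbar_mult M 0) by (simpl; f_equal; ring).
  apply is_lim_seq_scal_l.
  apply (is_lim_seq_ext (fun n => / INR (S n))); [intros n; now rewrite S_INR |].
  apply (is_lim_seq_incr_1 (fun n => / INR n)).
  replace (Finite 0) with (Rbar_inv p_infty) by reflexivity.
  apply is_lim_seq_inv; [apply is_lim_seq_INR | easy]. }
apply is_lim_seq_spec in Hlim.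
assert (Cau : forall p : C -> R, (forall z w, Rabs (p z - p w) <= Cmod (z - w)%C) ->
   exists l : R, is_lim_seq (fun n => p (u n)) l).
{ intros p Hp; apply ex_lim_seq_cauchy_corr; intros eps.
  destruct (Hlim (pos_div_2 eps)) as [N HN]; exists N; intros n m Hn Hm.
  specialize (HN N (Nat.le_refl _)); simpl in HN; apply Rabs_def2 in HN.
  pose proof (B N n Hn); pose proof (B N m Hm).
  pose proof (Hp (u n) (u N)); pose proof (Hp (u m) (u N)).
  replace (p (u n) - p (u m)) with ((p (u n) - p (u N)) + - (p (u m) - p (u N))) by ring.
  eapply Rle_lt_trans; [apply Rabs_triang |]; rewrite Rabs_Ropp; lra. }
destruct (Cau fst) as [l1 H1]; [intros z w; exact (abs_fst_le (z - w)%C) |].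
destruct (Cau snd) as [l2 H2]; [intros z w; exact (abs_snd_le (z - w)%C) |].
exists (l1, l2); apply Cseq_cv_parts; split; assumption.
Qed.

(** * Taylor bounds and infinite products *)

(** The bound on [df] is required only at points no farther from 0 than [x], so [M] may depend on
    [x]; the second-order estimate relies on this. *)
Lemma MVT_abs_le (f df : R -> R) (r M x : R) :
  (forall t, Rabs t <= r -> is_derive f t (df t)) ->
  (forall t, Rabs t <= r -> Rabs t <= Rabs x -> Rabs (df t) <= M) ->
  Rabs x <= r -> Rabs (f x - f 0) <= M * Rabs x.
Proof.
intros Hd HM Hx.
assert (I : forall t, Rmin 0 x <= t <= Rmax 0 x -> Rabs t <= Rabs x).
{ intros t; unfold Rmin, Rmax, Rabs; destruct (Rle_dec 0 x), (Rcase_abs t), (Rcase_abs x); lra. }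
destruct (MVT_gen f 0 x df) as [t [Ht E]].
- intros t Ht; apply Hd; eapply Rle_trans; [apply I; lra | exact Hx].
- intros t Ht; apply derivable_continuous_pt; exists (df t); apply is_derive_Reals, Hd.
  eapply Rle_trans; [apply I; lra | exact Hx].
- rewrite E, Rminus_0_r, Rabs_mult; apply Rmult_le_compat_r; [apply Rabs_pos |].
  pose proof (I t Ht); apply HM; lra.
Qed.

(** The mean value theorem is applied to [df], then to [f t - df 0 * t] with the bound [M * |x|]
    just found for its derivative. This loses the usual factor 1/2, which is harmless here. *)
Lemma taylor_second_order (f df ddf : R -> R) (r M x : R) :
  (forall t, Rabs t <= r -> is_derive f t (df t)) ->
  (forall t, Rabs t <= r -> is_derive df t (ddf t)) ->
  (forall t, Rabs t <= r -> Rabs (ddf t) <= M) ->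
  Rabs x <= r ->
  Rabs (df x - df 0) <= M * Rabs x /\ Rabs (f x - f 0 - df 0 * x) <= M * Rabs x ^ 2.
Proof.
intros H1 H2 HM Hx.
assert (D : forall t, Rabs t <= r -> Rabs (df t - df 0) <= M * Rabs t).
{ intros t Ht; apply (MVT_abs_le df ddf r); auto. }
split; [now apply D |].
pose proof (MVT_abs_le (fun t => f t - df 0 * t) (fun t => df t - df 0) r (M * Rabs x) x) as H.
simpl in H; replace (f x - f 0 - df 0 * x) with (f x - df 0 * x - (f 0 - df 0 * 0)) by ring.
replace (M * Rabs x ^ 2) with (M * Rabs x * Rabs x) by ring; apply H; [| | exact Hx].
- intros t Ht; apply (is_derive_minus (V := R_NormedModule)); [now apply H1 |].
  auto_derive; [easy | ring].
- intros t Ht Htx; eapply Rle_trans; [now apply D |].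
  assert (0 <= M) by (eapply Rle_trans; [apply Rabs_pos | apply (HM t Ht)]).
  now apply Rmult_le_compat_l.
Qed.

Lemma cos_sin_comb_le (a b x : R) : Rabs (a * cos x + b * sin x) <= Rabs a + Rabs b.
Proof.
pose proof (COS_bound x); pose proof (SIN_bound x).
eapply Rle_trans; [apply Rabs_triang |]; rewrite !Rabs_mult.
assert (Rabs (cos x) <= 1) by (apply Rabs_le; lra).
assert (Rabs (sin x) <= 1) by (apply Rabs_le; lra).
pose proof (Rabs_pos a); pose proof (Rabs_pos b); nra.
Qed.

Lemma Cmod_sqr (p q : R) : Cmod (p, q) ^ 2 = p ^ 2 + q ^ 2.
Proof. unfold Cmod; simpl fst; simpl snd; rewrite pow2_sqrt; [easy |]; nra. Qed.

(** Real Taylor estimate at [t = 1] for the two coordinates of [t |-> Cexp (t * w)]. Their second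
    derivatives are the coordinates of [w^2 * Cexp (t * w)], with coefficients [p^2 - q^2] and
    [2 p q]; each costs [2 |w|^2 exp |w|], whence the 4. *)
Lemma Cexp_taylor (w : C) : Cmod (Cexp w - 1 - w)%C <= 4 * Cmod w ^ 2 * exp (Cmod w).
Proof.
destruct w as [p q].
assert (K : forall A B : R, Rabs A + Rabs B <= 2 * (p ^ 2 + q ^ 2) ->
   forall t, Rabs t <= 1 ->
     Rabs (exp (t * p) * (A * cos (t * q) + B * sin (t * q))) <= 2 * Cmod (p, q) ^ 2 * exp (Cmod (p, q))).
{ intros A B HAB t Ht.
  rewrite Rabs_mult, Rmult_comm, Cmod_sqr.
  apply Rmult_le_compat; try apply Rabs_pos.
  - eapply Rle_trans; [apply cos_sin_comb_le | exact HAB].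
  - rewrite Rabs_pos_eq by (left; apply exp_pos).
    assert (t * p <= Cmod (p, q)).
    { pose proof (abs_fst_le (p, q)) as Hp; simpl in Hp.
      eapply Rle_trans; [apply Rle_abs |]; rewrite Rabs_mult.
      pose proof (Rabs_pos p); nra. }
    destruct (Req_dec (t * p) (Cmod (p, q))) as [-> |]; [lra | left; apply exp_increasing; lra]. }
assert (P : Rabs (p ^ 2 - q ^ 2) + Rabs (2 * p * q) <= 2 * (p ^ 2 + q ^ 2)).
{ unfold Rabs; destruct (Rcase_abs (p ^ 2 - q ^ 2)), (Rcase_abs (2 * p * q)); nra. }
eapply Rle_trans; [apply Cmod_le_abs |].
replace (4 * Cmod (p, q) ^ 2 * exp (Cmod (p, q)))
  with (2 * Cmod (p, q) ^ 2 * exp (Cmod (p, q)) + 2 * Cmod (p, q) ^ 2 * exp (Cmod (p, q))) by ring.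
apply Rplus_le_compat.
- destruct (taylor_second_order (fun t => exp (t * p) * cos (t * q))
    (fun t => exp (t * p) * (p * cos (t * q) - q * sin (t * q)))
    (fun t => exp (t * p) * ((p ^ 2 - q ^ 2) * cos (t * q) + (- (2 * p * q)) * sin (t * q)))
    1 (2 * Cmod (p, q) ^ 2 * exp (Cmod (p, q))) 1) as [_ H].
  + intros t _; auto_derive; [easy | ring].
  + intros t _; auto_derive; [easy | ring].
  + apply K; now rewrite Rabs_Ropp.
  + rewrite Rabs_R1; lra.
  + rewrite Rabs_R1, !Rmult_1_l, !Rmult_0_l, exp_0, cos_0, sin_0 in H.
    simpl; match goal with |- Rabs ?a <= _ => match type of H with Rabs ?b <= _ => replace a with b by ring end end.
    eapply Rle_trans; [exact H |]; right; ring.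
- destruct (taylor_second_order (fun t => exp (t * p) * sin (t * q))
    (fun t => exp (t * p) * (q * cos (t * q) + p * sin (t * q)))
    (fun t => exp (t * p) * ((2 * p * q) * cos (t * q) + (p ^ 2 - q ^ 2) * sin (t * q)))
    1 (2 * Cmod (p, q) ^ 2 * exp (Cmod (p, q))) 1) as [_ H].
  + intros t _; auto_derive; [easy | ring].
  + intros t _; auto_derive; [easy | ring].
  + apply K; now rewrite Rplus_comm.
  + rewrite Rabs_R1; lra.
  + rewrite Rabs_R1, !Rmult_1_l, !Rmult_0_l, exp_0, cos_0, sin_0 in H.
    simpl; match goal with |- Rabs ?a <= _ => match type of H with Rabs ?b <= _ => replace a with b by ring end end.
    eapply Rle_trans; [exact H |]; right; ring.
Qed.

Lemma Cexp_plus (z w : C) : Cexp (z + w)%C = (Cexp z * Cexp w)%C.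
Proof.
destruct z as [a b], w as [c d]; unfold Cexp; simpl; rewrite exp_plus, cos_plus, sin_plus.
unfold Cmult; simpl; f_equal; ring.
Qed.

Lemma Cexp_RtoC (t : R) : Cexp (RtoC t) = RtoC (exp t).
Proof. unfold Cexp, RtoC; simpl; rewrite cos_0, sin_0; f_equal; ring. Qed.

(** * Infinite products whose factors are summably close to 1 *)

Fixpoint Cpartial_prod (f : nat -> C) (n : nat) : C :=
  match n with O => RtoC 1 | S m => (Cpartial_prod f m * f m)%C end.

Section Products.

Variables (F d : nat -> C) (h : C) (A D : R).
Hypothesis HA : 0 <= A.
Hypothesis HD : 0 <= D.
Hypothesis HF : forall k, Cmod (F k - 1 - h * d k)%C <= A * Cmod h ^ 2 * gap k.
Hypothesis Hd : forall k, Cmod (d k) <= D * gap k.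

(** Chosen so that [|F k - 1| <= t * gap k]. *)
Let t := Cmod h * (A * Cmod h + D).
(** Closed form of the sum of [gap k] for [k < n]. The inductions below carry [s n] as a factor and
    replace it by 1 only at the end. *)
Let s (n : nat) := 1 - / (INR n + 1).

Let s_S n : s (S n) = s n + gap n.
Proof. unfold s, gap; rewrite S_INR; replace (INR n + 1 + 1) with (INR n + 2) by ring; ring. Qed.

Let s_bound n : 0 <= s n <= 1.
Proof.
unfold s; pose proof (pos_INR n).
assert (0 < / (INR n + 1)) by (apply Rinv_0_lt_compat; lra).
assert (/ (INR n + 1) <= / 1) by (apply Rinv_le_contravar; lra).
lra.
Qed.

Let t_pos : 0 <= t.
Proof. unfold t; pose proof (Cmod_ge_0 h); apply Rmult_le_pos; [easy |]; nra. Qed.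

Let factor_near_1 k : Cmod (F k - 1)%C <= t * gap k.
Proof.
replace (F k - 1)%C with ((F k - 1 - h * d k) + h * d k)%C by ring.
eapply Rle_trans; [apply Cmod_triangle |]; rewrite Cmod_mult.
specialize (HF k); specialize (Hd k); pose proof (Cmod_ge_0 h); unfold t.
assert (Cmod h * Cmod (d k) <= Cmod h * (D * gap k)) by (apply Rmult_le_compat_l; easy).
nra.
Qed.

(** Each factor has modulus at most [1 + t * gap k <= exp (t * gap k)], and the exponents add up to
    [t * s n <= t]. *)
Let prod_bounded n : Cmod (Cpartial_prod F n) <= exp t.
Proof.
apply Rle_trans with (exp (t * s n)).
- induction n as [|n IH].
  + simpl; rewrite Cmod_1; unfold s; simpl; replace (t * (1 - / (0 + 1))) with 0 by field.
    rewrite exp_0; lra.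
  + simpl; rewrite Cmod_mult, s_S, Rmult_plus_distr_l, exp_plus.
    apply Rmult_le_compat; try apply Cmod_ge_0; [exact IH |].
    replace (F n) with (1 + (F n - 1))%C by ring.
    eapply Rle_trans; [apply Cmod_triangle |]; rewrite Cmod_1.
    pose proof (factor_near_1 n); pose proof (exp_ineq1_le (t * gap n)); lra.
- pose proof (s_bound n); pose proof t_pos.
  destruct (Req_dec (t * s n) t) as [-> |]; [lra | left; apply exp_increasing; nra].
Qed.

Let prod_step n : Cmod (Cpartial_prod F (S n) - Cpartial_prod F n)%C <= exp t * t * gap n.
Proof.
simpl; replace (Cpartial_prod F n * F n - Cpartial_prod F n)%C
  with (Cpartial_prod F n * (F n - 1))%C by ring.
rewrite Cmod_mult, Rmult_assoc; apply Rmult_le_compat; try apply Cmod_ge_0; auto.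
Qed.

Lemma Cpartial_prod_cv : exists l : C, Cseq_cv (Cpartial_prod F) l.
Proof. apply (Cseq_cv_gap _ (exp t * t)); exact prod_step. Qed.

Let prod_near_1 n : Cmod (Cpartial_prod F n - 1)%C <= exp t * t.
Proof.
assert (0 <= exp t * t) by (apply Rmult_le_pos; [left; apply exp_pos | exact t_pos]).
apply Rle_trans with (exp t * t * s n); [| pose proof (s_bound n); nra].
induction n as [|n IH].
- simpl; replace (1 - 1)%C with (RtoC 0) by ring; rewrite Cmod_0; pose proof (s_bound 0); nra.
- replace (Cpartial_prod F (S n) - 1)%C
    with ((Cpartial_prod F (S n) - Cpartial_prod F n) + (Cpartial_prod F n - 1))%C by ring.
  eapply Rle_trans; [apply Cmod_triangle |].
  pose proof (prod_step n); rewrite s_S; lra.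
Qed.

(** One more factor adds [P_n (F_n - 1 - h d_n) + h d_n (P_n - 1)] to the error, where [P_n] is the
    partial product. The first term is small by hypothesis and by boundedness of [P_n]; in the
    second, [P_n - 1] brings another factor [|h|] through [t]. The bound is uniform in [n]. *)
Lemma Cpartial_prod_linear n :
  Cmod (Cpartial_prod F n - 1 - h * Cpartial d n)%C
    <= exp (Cmod h * (A * Cmod h + D)) * (A + D * (A * Cmod h + D)) * Cmod h ^ 2.
Proof.
fold t.
set (K := exp t * (A + D * (A * Cmod h + D)) * Cmod h ^ 2).
pose proof (Cmod_ge_0 h) as Hh; pose proof (exp_pos t) as He.
assert (HK : 0 <= K).
{ assert (0 <= A * Cmod h) by (apply Rmult_le_pos; easy).
  unfold K; apply Rmult_le_pos; [apply Rmult_le_pos; [lra |] | apply pow2_ge_0].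
  apply Rplus_le_le_0_compat; [easy | apply Rmult_le_pos; lra]. }
apply Rle_trans with (K * s n); [| pose proof (s_bound n); nra].
induction n as [|n IH].
- simpl; change (Cmod (1 - 1 - h * RtoC 0)%C <= K * s 0).
  replace (1 - 1 - h * 0)%C with (RtoC 0) by ring; rewrite Cmod_0; pose proof (s_bound 0); nra.
- change (Cpartial d (S n)) with (Cpartial d n + d n)%C.
  change (Cpartial_prod F (S n)) with (Cpartial_prod F n * F n)%C.
  replace (Cpartial_prod F n * F n - 1 - h * (Cpartial d n + d n))%C
    with (Cpartial_prod F n * (F n - 1 - h * d n) + h * d n * (Cpartial_prod F n - 1)
          + (Cpartial_prod F n - 1 - h * Cpartial d n))%C by ring.
  eapply Rle_trans; [apply Cmod_triangle |]; rewrite s_S, Rmult_plus_distr_l, Rplus_comm.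
  apply Rplus_le_compat; [exact IH |].
  eapply Rle_trans; [apply Cmod_triangle |]; rewrite !Cmod_mult.
  replace (K * gap n) with (exp t * (A * Cmod h ^ 2 * gap n) + Cmod h * (D * gap n) * (exp t * t))
    by (unfold K, t; ring).
  apply Rplus_le_compat.
  + apply Rmult_le_compat; try apply Cmod_ge_0; auto.
  + apply Rmult_le_compat; try apply Cmod_ge_0; auto.
    * apply Rmult_le_pos; apply Cmod_ge_0.
    * apply Rmult_le_compat_l; auto.
Qed.

End Products.

Lemma ln_0 : ln 0 = 0.
Proof. unfold ln; destruct (Rlt_dec 0 0) as [H | _]; [exfalso; lra | reflexivity]. Qed.

Lemma ln_le_minus_1 (x : R) : 0 < x -> ln x <= x - 1.
Proof. intros H; pose proof (exp_ineq1_le (ln x)); rewrite exp_ln in H0; lra. Qed.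

(* Since [0 - 1 = 0] and [ln 0 = 0], this vanishes for [k = 0] and [k = 1], so that the sum over
   [k <= n] is [ln n] for every [n]. *)
Definition logstep (k : nat) : R := ln (INR k) - ln (INR (k - 1)).

(** For [k >= 2], [ln x <= x - 1] gives [1/k <= logstep k <= 1/(k-1)]. The constants 3 and 8 are
    those that the comparison of these fractions requires at [k = 2]; the degenerate cases 0 and 1
    fit within them. *)
Lemma logstep_bound (k : nat) :
  0 <= logstep k <= 3 / (INR k + 1) /\ Rabs (logstep k - / (INR k + 1)) <= 8 * gap k.
Proof.
rewrite gap_eq; destruct k as [|[|n]].
- unfold logstep; simpl; rewrite ln_0; split; [lra |].
  rewrite Rabs_left1; lra.
- unfold logstep; simpl; rewrite ln_0, ln_1; split; [lra |].
  rewrite Rabs_left1; lra.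
- pose proof (pos_INR n) as Hn.
  unfold logstep; replace (S (S n) - 1)%nat with (S n) by lia.
  rewrite !S_INR; set (x := INR n) in *; replace (x + 1 + 1) with (x + 2) by ring.
  assert (U : ln (x + 2) - ln (x + 1) <= / (x + 1)).
  { rewrite <- ln_div by lra; eapply Rle_trans; [apply ln_le_minus_1, Rdiv_lt_0_compat; lra |].
    right; field; lra. }
  assert (L : / (x + 2) <= ln (x + 2) - ln (x + 1)).
  { assert (ln (x + 1) - ln (x + 2) <= - / (x + 2)); [| lra].
    rewrite <- ln_div by lra; eapply Rle_trans; [apply ln_le_minus_1, Rdiv_lt_0_compat; lra |].
    right; field; lra. }
  assert (0 < / (x + 2)) by (apply Rinv_0_lt_compat; lra).
  assert (/ (x + 1) <= 3 / (x + 2 + 1)).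
  { apply (Rmult_le_reg_l ((x + 1) * (x + 3))); [nra |].
    replace ((x + 1) * (x + 3) * / (x + 1)) with (x + 3) by (field; lra).
    replace ((x + 1) * (x + 3) * (3 / (x + 2 + 1))) with (3 * (x + 1)) by (field; lra).
    lra. }
  assert (/ (x + 2 + 1) <= / (x + 2)) by (apply Rinv_le_contravar; lra).
  split; [lra |].
  rewrite Rabs_pos_eq by lra.
  assert (/ (x + 1) - / (x + 2 + 1) <= 8 * / ((x + 2 + 1) * (x + 2 + 2))); [| lra].
  replace (/ (x + 1) - / (x + 2 + 1)) with (2 * / ((x + 1) * (x + 3))) by (field; lra).
  replace (x + 2 + 2) with (x + 4) by ring; replace (x + 2 + 1) with (x + 3) by ring.
  apply (Rmult_le_reg_l ((x + 1) * ((x + 3) * (x + 4)))); [apply Rmult_lt_0_compat; nra |].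
  replace ((x + 1) * ((x + 3) * (x + 4)) * (2 * / ((x + 1) * (x + 3)))) with (2 * (x + 4)) by (field; lra).
  replace ((x + 1) * ((x + 3) * (x + 4)) * (8 * / ((x + 3) * (x + 4)))) with (8 * (x + 1)) by (field; lra).
  lra.
Qed.

(** When [k >= 2 |z| + 1], one has [|z + k| >= k - |z| >= (k + 1) / 2]; the finitely many smaller
    [k] are handled by a minimum. Growth linear in [k] is what makes [1 / (z + k)] comparable with
    [1 / (k + 1)] in all later estimates. *)
Lemma nonpole_bound (z : C) :
  (forall k : nat, (z + INR k)%C <> 0) ->
  exists m, 0 < m /\ forall k, m * (INR k + 1) <= Cmod (z + INR k)%C.
Proof.
intros Hz.
destruct (INR_archimed 1 (2 * Cmod z + 1) Rlt_0_1) as [N HN].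
assert (Hfin : forall n, exists m, 0 < m /\ forall k, (k < n)%nat -> m * (INR k + 1) <= Cmod (z + INR k)%C).
{ induction n as [|n [m [Hm IH]]]; [exists 1; split; [lra | lia] |].
  assert (H0 : 0 < Cmod (z + INR n)%C) by (apply Cmod_gt_0, Hz).
  pose proof (pos_INR n) as Hn.
  exists (Rmin m (Cmod (z + INR n)%C / (INR n + 1))); split.
  - apply Rmin_pos; [easy | apply Rdiv_lt_0_compat; lra].
  - intros k Hk; pose proof (pos_INR k) as Hk'.
    destruct (Nat.eq_dec k n) as [-> | Hne].
    + eapply Rle_trans; [apply Rmult_le_compat_r; [lra | apply Rmin_r] |]; right; field; lra.
    + eapply Rle_trans; [apply Rmult_le_compat_r; [lra | apply Rmin_l] |]; apply IH; lia. }
destruct (Hfin N) as [m [Hm H]].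
exists (Rmin m (1 / 2)); split; [apply Rmin_pos; lra |].
intros k; pose proof (pos_INR k) as Hk'.
destruct (Nat.lt_ge_cases k N) as [Hk | Hk].
- eapply Rle_trans; [apply Rmult_le_compat_r; [lra | apply Rmin_l] |]; auto.
- eapply Rle_trans; [apply Rmult_le_compat_r; [lra | apply Rmin_r] |].
  apply le_INR in Hk.
  assert (INR k <= Cmod (z + INR k)%C + Cmod z); [| lra].
  rewrite <- (Rabs_pos_eq (INR k)) at 1 by easy; rewrite <- Cmod_R.
  replace (RtoC (INR k)) with ((z + INR k) + - z)%C at 1 by ring.
  eapply Rle_trans; [apply Cmod_triangle |]; rewrite Cmod_opp; lra.
Qed.

(** * The Gamma and digamma functions *)

(** The factor contributed by [k] to the ratio of Gauss's expressions at [z + h] and at [z]: [n^h]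
    is spread over the factors through [logstep]. *)
Definition gamma_factor (z h : C) (k : nat) : C :=
  (Cexp (h * RtoC (logstep k)) * (z + INR k) / (z + h + INR k))%C.

(** Derivative of [gamma_factor z h k] with respect to [h] at 0. The sum over [k <= n] is the
    classical [ln n - sum 1/(z+k)]. *)
Definition digamma_term (z : C) (k : nat) : C := (logstep k - / (z + INR k))%C.

(** Comparison with [1/(k+1)]: the difference [1/(k+1) - 1/(z+k)] equals [(z-1) / ((k+1)(z+k))], of
    order [1/k^2]. The 8 comes from [logstep_bound], the 2 from [1/(k+1)^2 <= 2 gap k]. *)
Lemma Cmod_digamma_term_le (z : C) (m : R) (k : nat) :
  0 < m -> m * (INR k + 1) <= Cmod (z + INR k)%C ->
  Cmod (digamma_term z k) <= (8 + 2 * Cmod (z - 1)%C / m) * gap k.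
Proof.
intros Hm Hz; pose proof (pos_INR k) as Hk.
assert (Hw : 0 < Cmod (z + INR k)%C) by nra.
assert (Hw0 : (z + INR k)%C <> 0) by now apply Cmod_gt_0.
assert (Hk1 : (INR k + 1)%C <> 0).
{ rewrite <- RtoC_plus; intros H; apply RtoC_inj in H; lra. }
unfold digamma_term.
replace (logstep k - / (z + INR k))%C
  with (RtoC (logstep k - / (INR k + 1)) + (z - 1) / ((INR k + 1) * (z + INR k)))%C.
2:{ rewrite RtoC_minus, RtoC_inv, RtoC_plus by lra; field; split; assumption. }
eapply Rle_trans; [apply Cmod_triangle |]; rewrite Rmult_plus_distr_r.
apply Rplus_le_compat.
- rewrite Cmod_R; apply logstep_bound.
- rewrite Cmod_div by (apply Cmult_neq_0; assumption).
  rewrite Cmod_mult, <- RtoC_plus, Cmod_R, Rabs_pos_eq by lra.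
  unfold Rdiv; rewrite (Rmult_comm 2), !Rmult_assoc.
  apply Rmult_le_compat_l; [apply Cmod_ge_0 |].
  rewrite gap_eq.
  apply Rle_trans with (/ ((INR k + 1) * (m * (INR k + 1)))).
  + apply Rinv_le_contravar; [apply Rmult_lt_0_compat; nra | apply Rmult_le_compat_l; lra].
  + replace (2 * (/ m * / ((INR k + 1) * (INR k + 2))))
      with (2 * / (m * (INR k + 1) * (INR k + 2))) by (field; lra).
    apply (Rmult_le_reg_l (m * (INR k + 1) * (INR k + 1) * (INR k + 2))).
    * repeat apply Rmult_lt_0_compat; lra.
    * replace (m * (INR k + 1) * (INR k + 1) * (INR k + 2) * / ((INR k + 1) * (m * (INR k + 1))))
        with (INR k + 2) by (field; lra).
      replace (m * (INR k + 1) * (INR k + 1) * (INR k + 2) * (2 * / (m * (INR k + 1) * (INR k + 2))))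
        with (2 * (INR k + 1)) by (field; lra).
      lra.
Qed.

Lemma inv_sqr_le_gap (k : nat) : / (INR k + 1) ^ 2 <= 2 * gap k.
Proof.
pose proof (pos_INR k); rewrite gap_eq.
apply (Rmult_le_reg_l ((INR k + 1) ^ 2 * (INR k + 2))); [apply Rmult_lt_0_compat; nra |].
replace ((INR k + 1) ^ 2 * (INR k + 2) * / (INR k + 1) ^ 2) with (INR k + 2) by (field; lra).
replace ((INR k + 1) ^ 2 * (INR k + 2) * (2 * / ((INR k + 1) * (INR k + 2))))
  with (2 * (INR k + 1)) by (field; lra).
lra.
Qed.

(** Multiplied by [z + h + k], the error becomes [(z+k) (exp(hL) - 1 - hL) - h^2 d_k] with
    [L = logstep k]: everything linear in [h] cancels. Taylor with [L <= 3/(k+1)] gives 4 * 9 = 36,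
    doubled by [inv_sqr_le_gap]. The bound [H] keeps the exponential in the constant independent of
    [h]. *)
Lemma gamma_factor_linear (z h : C) (m H : R) (k : nat) :
  0 < m -> m * (INR k + 1) <= Cmod (z + INR k)%C -> m * (INR k + 1) <= Cmod (z + h + INR k)%C ->
  Cmod h <= H ->
  Cmod (gamma_factor z h k - 1 - h * digamma_term z k)%C
    <= (72 * (Cmod z + 1) / m * exp (3 * H) + (8 + 2 * Cmod (z - 1)%C / m) / m) * Cmod h ^ 2 * gap k.
Proof.
intros Hm Hz Hzh HH; pose proof (pos_INR k) as Hk.
pose proof (Cmod_ge_0 h) as Hh0; pose proof (gap_pos k) as Hg.
assert (Hw0 : (z + INR k)%C <> 0) by (apply Cmod_gt_0; nra).
assert (Hwh0 : (z + h + INR k)%C <> 0) by (apply Cmod_gt_0; nra).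
assert (Hwh : 0 < Cmod (z + h + INR k)%C) by (apply Cmod_gt_0; easy).
replace (gamma_factor z h k - 1 - h * digamma_term z k)%C
  with (((z + INR k) * (Cexp (h * logstep k) - 1 - h * logstep k) + - (h * h * digamma_term z k))
        / (z + h + INR k))%C
  by (unfold gamma_factor, digamma_term; field; split; assumption).
rewrite Cmod_div by easy.
apply (Rmult_le_reg_r (Cmod (z + h + INR k)%C)); [easy |].
unfold Rdiv at 1; rewrite Rmult_assoc, Rinv_l, Rmult_1_r by lra.
eapply Rle_trans; [apply Cmod_triangle |].
rewrite Cmod_opp, !Cmod_mult.
set (D := 8 + 2 * Cmod (z - 1)%C / m).
set (B := 72 * (Cmod z + 1) / m * exp (3 * H)).
assert (HD : Cmod (digamma_term z k) <= D * gap k) by (now apply Cmod_digamma_term_le).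
assert (HD0 : 0 <= D).
{ unfold D, Rdiv; apply Rplus_le_le_0_compat; [lra |].
  apply Rmult_le_pos; [pose proof (Cmod_ge_0 (z - 1)%C); lra | left; now apply Rinv_0_lt_compat]. }
assert (HB0 : 0 <= B).
{ unfold B, Rdiv; apply Rmult_le_pos; [| left; apply exp_pos].
  apply Rmult_le_pos; [pose proof (Cmod_ge_0 z); lra | left; now apply Rinv_0_lt_compat]. }
assert (Hh2 : 0 <= Cmod h ^ 2) by apply pow2_ge_0.
apply Rle_trans with ((B + D / m) * Cmod h ^ 2 * gap k * (m * (INR k + 1))).
2:{ apply Rmult_le_compat_l; [| easy].
    apply Rmult_le_pos; [apply Rmult_le_pos; [| easy] | lra].
    apply Rplus_le_le_0_compat; [easy |].
    apply Rmult_le_pos; [easy | left; now apply Rinv_0_lt_compat]. }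
replace ((B + D / m) * Cmod h ^ 2 * gap k * (m * (INR k + 1)))
  with (B * m * (INR k + 1) * Cmod h ^ 2 * gap k + Cmod h * Cmod h * (D * gap k) * (INR k + 1))
  by (field; lra).
apply Rplus_le_compat.
- destruct (logstep_bound k) as [[L0 L1] _].
  assert (HL : Cmod (h * logstep k)%C <= Cmod h * (3 / (INR k + 1))).
  { rewrite Cmod_mult, Cmod_R, Rabs_pos_eq by easy; now apply Rmult_le_compat_l. }
  assert (H3 : 3 / (INR k + 1) <= 3).
  { apply (Rmult_le_reg_r (INR k + 1)); [lra |]; unfold Rdiv; rewrite Rmult_assoc, Rinv_l; lra. }
  assert (HL3 : Cmod (h * logstep k)%C <= 3 * H) by (pose proof (Cmod_ge_0 h); nra).
  assert (Hz1 : Cmod (z + INR k)%C <= (Cmod z + 1) * (INR k + 1)).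
  { eapply Rle_trans; [apply Cmod_triangle |]; rewrite Cmod_R, Rabs_pos_eq by easy.
    pose proof (Cmod_ge_0 z); nra. }
  assert (He : Cmod (Cexp (h * logstep k) - 1 - h * logstep k)%C
     <= 4 * (Cmod h * (3 / (INR k + 1))) ^ 2 * exp (3 * H)).
  { eapply Rle_trans; [apply Cexp_taylor |].
    apply Rmult_le_compat; [| left; apply exp_pos | |].
    - pose proof (pow2_ge_0 (Cmod (h * logstep k)%C)); lra.
    - apply Rmult_le_compat_l; [lra |]; apply pow_incr; split; [apply Cmod_ge_0 | easy].
    - destruct (Req_dec (Cmod (h * logstep k)%C) (3 * H)) as [-> |]; [lra |].
      left; apply exp_increasing; lra. }
  eapply Rle_trans; [apply Rmult_le_compat; [apply Cmod_ge_0 | apply Cmod_ge_0 | exact Hz1 | exact He] |].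
  replace (B * m * (INR k + 1) * Cmod h ^ 2 * gap k)
    with ((36 * (Cmod z + 1) * (INR k + 1) * Cmod h ^ 2 * exp (3 * H)) * (2 * gap k))
    by (unfold B; field; lra).
  replace ((Cmod z + 1) * (INR k + 1) * (4 * (Cmod h * (3 / (INR k + 1))) ^ 2 * exp (3 * H)))
    with ((36 * (Cmod z + 1) * (INR k + 1) * Cmod h ^ 2 * exp (3 * H)) * / (INR k + 1) ^ 2)
    by (field; lra).
  apply Rmult_le_compat_l; [| apply inv_sqr_le_gap].
  pose proof (Cmod_ge_0 z); pose proof (exp_pos (3 * H)).
  repeat apply Rmult_le_pos; lra.
- rewrite <- (Rmult_1_r (Cmod h * Cmod h * Cmod (digamma_term z k))).
  apply Rmult_le_compat; [| lra | | lra].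
  + repeat apply Rmult_le_pos; apply Cmod_ge_0.
  + apply Rmult_le_compat_l; [nra | easy].
Qed.

Definition gauss_gamma (n : nat) (z : C) : C :=
  (INR (fact n) * Cnatpow n z / Cprod_list (map (fun k => z + INR k)%C (seq 0 (S n))))%C.

Lemma Cprod_list_seq_S (f : nat -> C) (n : nat) :
  Cprod_list (map f (seq 0 (S n))) = (Cprod_list (map f (seq 0 n)) * f n)%C.
Proof.
rewrite seq_S, map_app; simpl.
generalize (map f (seq 0 n)); induction l as [|x l IH]; simpl.
- change (f n * 1 = 1 * f n)%C; ring.
- change (x * Cprod_list (l ++ [f n]) = x * Cprod_list l * f n)%C; rewrite IH; ring.
Qed.

Lemma Cprod_list_neq_0 (f : nat -> C) (n : nat) :
  (forall k, f k <> 0) -> Cprod_list (map f (seq 0 n)) <> RtoC 0.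
Proof.
intros Hf; induction n as [|n IH].
- simpl; exact C1_nz.
- rewrite Cprod_list_seq_S; now apply Cmult_neq_0.
Qed.

(** The logarithms telescope to [ln (n - 1)], the last index being [n - 1]. For [n = 0] the
    truncated subtraction and [ln 0 = 0] make the formula hold as well. *)
Lemma gamma_factor_prod (z h : C) (n : nat) :
  (forall k : nat, (z + INR k)%C <> 0) -> (forall k : nat, (z + h + INR k)%C <> 0) ->
  Cpartial_prod (gamma_factor z h) n =
  (Cexp (h * RtoC (ln (INR (n - 1)))) * Cprod_list (map (fun k => z + INR k) (seq 0 n))
    / Cprod_list (map (fun k => z + h + INR k) (seq 0 n)))%C.
Proof.
intros Hz Hzh; induction n as [|n IH].
- simpl; rewrite ln_0; replace (h * 0)%C with (RtoC 0) by ring; rewrite Cexp_RtoC, exp_0.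
  change (RtoC 1 = 1 * 1 / 1)%C; field.
- simpl Cpartial_prod; rewrite IH, !Cprod_list_seq_S.
  replace (ln (INR (S n - 1))) with (ln (INR (n - 1)) + logstep n)
    by (unfold logstep; replace (S n - 1)%nat with n by lia; ring).
  rewrite RtoC_plus, Cmult_plus_distr_l, Cexp_plus; unfold gamma_factor.
  field; split; [apply Hzh | now apply Cprod_list_neq_0].
Qed.

Lemma gauss_gamma_shift (z h : C) (n : nat) :
  (forall k : nat, (z + INR k)%C <> 0) -> (forall k : nat, (z + h + INR k)%C <> 0) ->
  gauss_gamma n (z + h)%C = (gauss_gamma n z * Cpartial_prod (gamma_factor z h) (S n))%C.
Proof.
intros Hz Hzh; rewrite gamma_factor_prod by easy.
replace (S n - 1)%nat with n by lia; unfold gauss_gamma.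
assert (E : Cnatpow n (z + h)%C = (Cnatpow n z * Cexp (h * RtoC (ln (INR n))))%C).
{ unfold Cnatpow; rewrite <- Cexp_plus; f_equal.
  change ((z + h) * RtoC (ln (INR n)) = z * RtoC (ln (INR n)) + h * RtoC (ln (INR n)))%C; ring. }
rewrite E; field; split; now apply Cprod_list_neq_0.
Qed.

Lemma gauss_gamma_1 : Cseq_cv (fun n => gauss_gamma n 1) (RtoC 1).
Proof.
(* Index 0 is skipped because [Cnatpow 0 1] is [exp 0 = 1] by the convention on [ln 0]; from 1 on,
   the sequence is [n! n / (n+1)! = 1 - 1/(n+1)]. *)
apply Cseq_cv_of_shift.
apply (Cseq_cv_ext (fun n => RtoC (1 - / (INR (S n) + 1)))).
- intros n; unfold gauss_gamma.
  assert (P : forall n, Cprod_list (map (fun k => 1 + INR k)%C (seq 0 n)) = RtoC (INR (fact n))).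
  { induction n0 as [|j IH]; [reflexivity |].
    rewrite Cprod_list_seq_S, IH, fact_simpl, mult_INR, S_INR, <- RtoC_plus, <- RtoC_mult.
    f_equal; ring. }
  assert (E : Cnatpow (S n) (RtoC 1) = RtoC (INR (S n))).
  { unfold Cnatpow; change (Cexp (RtoC 1 * RtoC (ln (INR (S n))))%C = RtoC (INR (S n))).
    rewrite Cmult_1_l, Cexp_RtoC, exp_ln by (apply lt_0_INR; lia); reflexivity. }
  rewrite P, E, <- RtoC_mult, <- RtoC_div by (apply not_0_INR, fact_neq_0).
  f_equal; rewrite (fact_simpl (S n)), mult_INR, (S_INR (S n)).
  pose proof (pos_INR (S n)); pose proof (INR_fact_neq_0 (S n)); field; lra.
- apply Cseq_cv_RtoC.
  replace (Finite 1) with (Finite (1 - 0)) by (f_equal; ring).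
  apply is_lim_seq_minus'; [apply is_lim_seq_const |].
  apply (is_lim_seq_ext (fun n => / INR (S (S n)))); [intros n; now rewrite (S_INR (S n)) |].
  apply (is_lim_seq_incr_1 (fun n => / INR (S n))).
  apply (is_lim_seq_incr_1 (fun n => / INR n)).
  replace (Finite 0) with (Rbar_inv p_infty) by reflexivity.
  apply is_lim_seq_inv; [apply is_lim_seq_INR | easy].
Qed.

Lemma nonpole_1 (k : nat) : (1 + INR k)%C <> 0.
Proof. rewrite <- RtoC_plus; intros H; apply RtoC_inj in H; pose proof (pos_INR k); lra. Qed.

Lemma gamma_factor_prod_cv (z h : C) :
  (forall k : nat, (z + INR k)%C <> 0) -> (forall k : nat, (z + h + INR k)%C <> 0) ->
  exists l : C, Cseq_cv (fun n => Cpartial_prod (gamma_factor z h) (S n)) l.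
Proof.
intros Hz Hzh.
destruct (nonpole_bound z Hz) as [m1 [Hm1 B1]].
destruct (nonpole_bound (z + h)%C Hzh) as [m2 [Hm2 B2]].
set (m := Rmin m1 m2).
assert (Hm : 0 < m) by now apply Rmin_pos.
assert (Bz : forall k, m * (INR k + 1) <= Cmod (z + INR k)%C).
{ intros k; eapply Rle_trans; [| apply B1]; apply Rmult_le_compat_r; [| apply Rmin_l].
  pose proof (pos_INR k); lra. }
assert (Bzh : forall k, m * (INR k + 1) <= Cmod (z + h + INR k)%C).
{ intros k; eapply Rle_trans; [| apply B2]; apply Rmult_le_compat_r; [| apply Rmin_r].
  pose proof (pos_INR k); lra. }
assert (Hi : 0 <= / m) by (left; now apply Rinv_0_lt_compat).
assert (HD : 0 <= 8 + 2 * Cmod (z - 1)%C / m).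
{ apply Rplus_le_le_0_compat; [lra |]; apply Rmult_le_pos; [| easy].
  pose proof (Cmod_ge_0 (z - 1)%C); lra. }
destruct (Cpartial_prod_cv (gamma_factor z h) (digamma_term z) h
  (72 * (Cmod z + 1) / m * exp (3 * Cmod h) + (8 + 2 * Cmod (z - 1)%C / m) / m)
  (8 + 2 * Cmod (z - 1)%C / m)) as [l Hl].
- apply Rplus_le_le_0_compat; [| now apply Rmult_le_pos].
  apply Rmult_le_pos; [| left; apply exp_pos].
  apply Rmult_le_pos; [pose proof (Cmod_ge_0 z); lra | easy].
- exact HD.
- intros k; apply gamma_factor_linear; auto; lra.
- intros k; now apply Cmod_digamma_term_le.
- exists l; apply (Cseq_cv_comp _ _ S) in Hl; [exact Hl | intros; lia].
Qed.

(** The shift [h = z - 1] starts from the point 1, where the limit is explicit, and multiplies by a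
    convergent product. *)
Lemma gauss_gamma_cv (z : C) :
  (forall k : nat, (z + INR k)%C <> 0) -> Cseq_cv (fun n => gauss_gamma n z) (CGamma z).
Proof.
intros Hz.
assert (Hz' : forall k : nat, (1 + (z - 1) + INR k)%C <> 0).
{ intros k; replace (1 + (z - 1) + INR k)%C with (z + INR k)%C by ring; apply Hz. }
destruct (gamma_factor_prod_cv 1 (z - 1)%C nonpole_1 Hz') as [l Hl].
assert (L : Cseq_cv (fun n => gauss_gamma n z) (1 * l)%C).
{ apply (Cseq_cv_ext (fun n => gauss_gamma n 1 * Cpartial_prod (gamma_factor 1 (z - 1)%C) (S n))%C).
  - intros n; rewrite <- gauss_gamma_shift by (assumption || exact nonpole_1).
    f_equal; ring.
  - apply Cseq_cv_mult; [exact gauss_gamma_1 | exact Hl]. }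
replace (CGamma z) with (1 * l)%C; [exact L |].
symmetry; apply Clim_seq_eq; exact L.
Qed.

(** The opposite shift [h = 1 - z] writes the limit 1 at the point 1 as [CGamma z] times a finite
    number. *)
Lemma CGamma_neq_0 (z : C) : (forall k : nat, (z + INR k)%C <> 0) -> CGamma z <> RtoC 0.
Proof.
intros Hz E.
assert (H1 : forall k : nat, (z + (1 - z) + INR k)%C <> 0).
{ intros k; replace (z + (1 - z) + INR k)%C with (1 + INR k)%C by ring; apply nonpole_1. }
destruct (gamma_factor_prod_cv z (1 - z)%C Hz H1) as [l Hl].
pose proof (Cseq_cv_mult _ _ _ _ (gauss_gamma_cv z Hz) Hl) as L.
apply C1_nz; apply (Cseq_cv_unique (fun n => gauss_gamma n 1)); [exact gauss_gamma_1 |].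
replace (RtoC 0) with (CGamma z * l)%C by (rewrite E; ring).
eapply Cseq_cv_ext; [| exact L]; intros n; cbv beta.
rewrite <- gauss_gamma_shift by assumption; f_equal; ring.
Qed.

Lemma Cderiv_at_unique (f : C -> C) (z L L' : C) : Cderiv_at f z L -> Cderiv_at f z L' -> L = L'.
Proof.
intros H H'; apply Ceq_minus, Cmod_eq_0, Rle_antisym; [| apply Cmod_ge_0].
apply le_epsilon; intros eps Heps.
destruct (H (eps / 2) ltac:(lra)) as [d1 [Hd1 B1]].
destruct (H' (eps / 2) ltac:(lra)) as [d2 [Hd2 B2]].
set (t := Rmin d1 d2 / 2).
assert (0 < Rmin d1 d2) by now apply Rmin_pos.
pose proof (Rmin_l d1 d2); pose proof (Rmin_r d1 d2).
assert (Ht : Cmod (RtoC t) = t) by (rewrite Cmod_R, Rabs_pos_eq; unfold t; lra).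
specialize (B1 (RtoC t)); specialize (B2 (RtoC t)).
change (Cnorm (RtoC t)) with (Cmod (RtoC t)) in B1, B2; rewrite Ht in B1, B2.
specialize (B1 ltac:(unfold t; lra)); specialize (B2 ltac:(unfold t; lra)).
set (q := ((f (z + t) - f z) / t)%C).
change (Cmod (q - L)%C < eps / 2) in B1; change (Cmod (q - L')%C < eps / 2) in B2.
replace (L - L')%C with ((q - L') + - (q - L))%C by ring.
eapply Rle_trans; [apply Cmod_triangle |]; rewrite Cmod_opp; lra.
Qed.

Lemma Cderiv_eq (f : C -> C) (z L : C) : Cderiv_at f z L -> Cderiv f z = L.
Proof.
intros H; apply (Cderiv_at_unique f z); [| exact H].
apply (epsilon_spec (inhabits Czero) (fun L => Cderiv_at f z L)); exists L; exact H.
Qed.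

Lemma Cderiv_at_quadratic (f : C -> C) (z L : C) (K r : R) :
  0 < r ->
  (forall h, Cmod h <= r -> Cmod (f (z + h) - f z - h * L)%C <= K * Cmod h ^ 2) -> Cderiv_at f z L.
Proof.
intros Hr H eps Heps.
assert (HK : 0 <= Rabs K) by apply Rabs_pos.
exists (Rmin r (eps / (Rabs K + 1))); split.
- apply Rlt_gt, Rmin_pos; [easy | apply Rdiv_lt_0_compat; lra].
- intros h [Hh0 Hh]; change C in h.
  change (0 < Cmod h) in Hh0; change (Cmod h < Rmin r (eps / (Rabs K + 1))) in Hh.
  change (Cmod ((f (z + h) - f z) / h - L)%C < eps).
  assert (Hn : h <> RtoC 0) by now apply Cmod_gt_0.
  replace ((f (z + h) - f z) / h - L)%C with ((f (z + h) - f z - h * L) / h)%C by now field.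
  rewrite Cmod_div by easy.
  pose proof (Rmin_l r (eps / (Rabs K + 1))); pose proof (Rmin_r r (eps / (Rabs K + 1))).
  apply (Rmult_lt_reg_r (Cmod h)); [easy |].
  unfold Rdiv; rewrite Rmult_assoc, Rinv_l, Rmult_1_r by lra.
  eapply Rle_lt_trans; [apply H; lra |].
  replace (K * Cmod h ^ 2) with (K * Cmod h * Cmod h) by ring.
  apply Rmult_lt_compat_r; [easy |].
  assert (Cmod h * (Rabs K + 1) < eps).
  { replace eps with (eps / (Rabs K + 1) * (Rabs K + 1)) by (field; lra).
    apply Rmult_lt_compat_r; lra. }
  pose proof (Rle_abs K); nra.
Qed.

(** In the limit [n -> oo], [Cpartial_prod_linear] says that [CGamma (z+h)] is
    [CGamma z * (1 + h psi)] up to [O(|h|^2)], where [psi] is the sum of the digamma terms. Hence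
    the derivative is [CGamma z * psi], and [CGamma z] can be divided out. *)
Lemma Psi_cv (z : C) :
  (forall k : nat, (z + INR k)%C <> 0) -> Cseq_cv (Cpartial (digamma_term z)) (Psi z).
Proof.
intros Hz.
destruct (nonpole_bound z Hz) as [m0 [Hm0 B0]].
(* Halving leaves room for a perturbation: if [|h| <= m] then [|z + h + k| >= 2 m (k + 1) - m >= m
   (k + 1)], so one [m] serves every such [h]. *)
set (m := m0 / 2); assert (Hm : 0 < m) by (unfold m; lra).
set (D := 8 + 2 * Cmod (z - 1)%C / m).
assert (Bz : forall k, m * (INR k + 1) <= Cmod (z + INR k)%C).
{ intros k; specialize (B0 k); pose proof (pos_INR k); unfold m; nra. }
assert (Bzh : forall h, Cmod h <= m -> forall k, m * (INR k + 1) <= Cmod (z + h + INR k)%C).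
{ intros h Hh k; specialize (B0 k); pose proof (pos_INR k).
  pose proof (Cmod_triangle (z + h + INR k)%C (- h)%C) as T; rewrite Cmod_opp in T.
  replace (z + h + INR k + - h)%C with (z + INR k)%C in T by ring.
  unfold m in *; nra. }
assert (Dz : forall k, Cmod (digamma_term z k) <= D * gap k) by (intros k; now apply Cmod_digamma_term_le).
destruct (Cseq_cv_gap (Cpartial (digamma_term z)) D) as [psi Hpsi].
{ intros n.
  change (Cpartial (digamma_term z) (S n)) with (Cpartial (digamma_term z) n + digamma_term z n)%C.
  replace (Cpartial (digamma_term z) n + digamma_term z n - Cpartial (digamma_term z) n)%C
    with (digamma_term z n) by ring.
  apply Dz. }
assert (Hi : 0 <= / m) by (left; now apply Rinv_0_lt_compat).
assert (HD : 0 <= D).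
{ apply Rplus_le_le_0_compat; [lra |]; apply Rmult_le_pos; [| easy].
  pose proof (Cmod_ge_0 (z - 1)%C); lra. }
set (A := 72 * (Cmod z + 1) / m * exp (3 * m) + D / m).
assert (HA : 0 <= A).
{ apply Rplus_le_le_0_compat; [| now apply Rmult_le_pos].
  apply Rmult_le_pos; [| left; apply exp_pos].
  apply Rmult_le_pos; [pose proof (Cmod_ge_0 z); lra | easy]. }
assert (HG : CGamma z <> RtoC 0) by now apply CGamma_neq_0.
assert (Hder : Cderiv_at CGamma z (CGamma z * psi)%C).
{ apply (Cderiv_at_quadratic CGamma z (CGamma z * psi)%C
    (Cmod (CGamma z) * (exp (m * (A * m + D)) * (A + D * (A * m + D)))) m Hm).
  intros h Hh.
  assert (Hzh : forall k : nat, (z + h + INR k)%C <> 0).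
  { intros k; apply Cmod_gt_0; pose proof (Bzh h Hh k); pose proof (pos_INR k); nra. }
  destruct (gamma_factor_prod_cv z h Hz Hzh) as [P HP].
  assert (E : CGamma (z + h)%C = (CGamma z * P)%C).
  { apply (Cseq_cv_unique (fun n => gauss_gamma n (z + h)%C)); [now apply gauss_gamma_cv |].
    apply (Cseq_cv_ext (fun n => gauss_gamma n z * Cpartial_prod (gamma_factor z h) (S n))%C).
    - intros n; now rewrite gauss_gamma_shift.
    - apply Cseq_cv_mult; [now apply gauss_gamma_cv | exact HP]. }
  change (Cadd z h) with (z + h)%C; rewrite E.
  replace (CGamma z * P - CGamma z - h * (CGamma z * psi))%C
    with (CGamma z * (P - 1 - h * psi))%C by ring.
  rewrite Cmod_mult, Rmult_assoc; apply Rmult_le_compat_l; [apply Cmod_ge_0 |].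
  apply (Cseq_cv_Cmod_le (fun n => Cpartial_prod (gamma_factor z h) (S n) - 1
                                   - h * Cpartial (digamma_term z) (S n))%C).
  - intros n; eapply Rle_trans.
    + apply (Cpartial_prod_linear _ _ _ A D); auto.
      intros k; apply gamma_factor_linear; auto.
    + apply Rmult_le_compat_r; [apply pow2_ge_0 |].
      pose proof (Cmod_ge_0 h) as Hh0.
      assert (A1 : 0 <= A * Cmod h) by now apply Rmult_le_pos.
      assert (A2 : A * Cmod h <= A * m) by now apply Rmult_le_compat_l.
      apply Rmult_le_compat.
      * left; apply exp_pos.
      * apply Rplus_le_le_0_compat; [easy | apply Rmult_le_pos; lra].
      * assert (Ht : Cmod h * (A * Cmod h + D) <= m * (A * m + D))
          by (apply Rmult_le_compat; lra).
        destruct (Req_dec (Cmod h * (A * Cmod h + D)) (m * (A * m + D))) as [-> |]; [lra |].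
        left; apply exp_increasing; lra.
      * apply Rplus_le_compat_l, Rmult_le_compat_l; lra.
  - apply Cseq_cv_minus; [apply Cseq_cv_minus; [exact HP | apply Cseq_cv_const] |].
    apply Cseq_cv_scal; apply (Cseq_cv_comp _ _ S) in Hpsi; [exact Hpsi | intros; lia]. }
replace (Psi z) with psi; [exact Hpsi |].
unfold Psi; rewrite (Cderiv_eq _ _ _ Hder).
change (@eq C psi (CGamma z * psi / CGamma z)%C); now field.
Qed.

(** * The partial fraction series of the secant *)

(** 8/5 is the rational stand-in for [PI / 2] up to which [sin x >= x / 2] is proved from the Taylor
    polynomial; it stays below 2, the radius on which the function [g] of the next section is
    controlled. *)
Lemma half_PI_lt : 1 < PI / 2 < 8 / 5.
Proof.
pose proof (PI_ineq 10) as [_ U]; pose proof PI2_1.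
unfold tg_alt, PI_tg in U; simpl in U; lra.
Qed.

Lemma sin_ge_half (x : R) : 0 <= x <= 8 / 5 -> x / 2 <= sin x.
Proof.
intros [H0 H1]; destruct half_PI_lt as [P _].
destruct (SIN x H0 ltac:(lra)) as [L _].
unfold sin_lb, sin_approx, sin_term in L; simpl in L.
assert (x * x <= 64 / 25) by nra.
assert (0 <= x * (64 / 25 - x * x)) by (apply Rmult_le_pos; lra).
assert (0 <= x * x * x) by (repeat apply Rmult_le_pos; lra).
assert (0 <= x * x * x * (64 / 25 - x * x) * (x*x)) by (repeat apply Rmult_le_pos; nra).
assert (0 <= x * x * x * x * x) by (repeat apply Rmult_le_pos; lra).
assert (x * x * x * x * x * x * x <= 64/25 * (x * x * x * x * x)) by nra.
lra.
Qed.

Lemma Rabs_sin_ge_half (x : R) : Rabs x <= 8 / 5 -> Rabs x / 2 <= Rabs (sin x).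
Proof.
intros H; destruct (Rle_or_lt 0 x) as [Hx | Hx].
- rewrite (Rabs_pos_eq x) in * by easy.
  eapply Rle_trans; [apply sin_ge_half; lra | apply Rle_abs].
- rewrite (Rabs_left x) in * by easy.
  rewrite <- Rabs_Ropp, <- sin_neg.
  eapply Rle_trans; [apply sin_ge_half; lra | apply Rle_abs].
Qed.

Lemma Rabs_sin_le (x : R) : Rabs (sin x) <= Rabs x.
Proof.
pose proof (MVT_abs_le sin cos (Rabs x) 1 x) as H.
rewrite sin_0, Rminus_0_r, Rmult_1_l in H; apply H.
- intros t _; apply is_derive_Reals, derivable_pt_lim_sin.
- intros t _ _; apply Rabs_le; pose proof (COS_bound t); lra.
- lra.
Qed.

(** * Decay of an integral against the Dirichlet kernel *)

Section DirichletKernel.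

Variables (g dg ddg : R -> R) (M : R) (n : nat) (D E : R -> R).
Hypothesis Hn : (0 < n)%nat.
Hypothesis Hg : forall t, Rabs t <= 2 -> is_derive g t (dg t).
Hypothesis Hdg : forall t, Rabs t <= 2 -> is_derive dg t (ddg t).
Hypothesis Hddg : forall t, Rabs t <= 2 -> Rabs (ddg t) <= M.
Hypothesis g0 : g 0 = 0.
Hypothesis dg0 : dg 0 = 0.
Hypothesis HD : forall x, D x * sin x = sin (2 * INR n * x).
Hypothesis HE : forall x, is_derive E x (g x * D x).
Hypothesis E0 : E 0 = 0.

Let g_bound x : Rabs x <= 2 -> Rabs (dg x) <= M * Rabs x /\ Rabs (g x) <= M * Rabs x ^ 2.
Proof.
intros Hx; destruct (taylor_second_order g dg ddg 2 M x Hg Hdg Hddg Hx) as [H1 H2].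
rewrite dg0, g0, Rmult_0_l, !Rminus_0_r in H2; rewrite dg0, Rminus_0_r in H1; easy.
Qed.

Let M_pos : 0 <= M.
Proof. eapply Rle_trans; [apply Rabs_pos | apply (Hddg 0); rewrite Rabs_R0; lra]. Qed.

(** At 0 the numerator vanishes, so this quotient is 0 there, which is also its limit; [h] is thus
    continuous at 0 without a case distinction. *)
Let h x := g x / sin x.
Let dh x := (dg x * sin x - g x * cos x) / sin x ^ 2.

Let h_bound x : Rabs x <= 8 / 5 -> Rabs (h x) <= 2 * M * Rabs x.
Proof.
intros Hx; unfold h.
destruct (Req_dec x 0) as [-> | H0].
- rewrite g0; unfold Rdiv; rewrite Rmult_0_l, !Rabs_R0; lra.
- destruct (g_bound x ltac:(lra)) as [_ B]; pose proof (Rabs_sin_ge_half x Hx) as S.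
  assert (0 < Rabs x) by now apply Rabs_pos_lt.
  unfold Rdiv; rewrite Rabs_mult, Rabs_inv.
  apply (Rmult_le_reg_r (Rabs (sin x))); [lra |].
  rewrite Rmult_assoc, Rinv_l, Rmult_1_r by lra.
  eapply Rle_trans; [exact B |].
  replace (M * Rabs x ^ 2) with (2 * M * Rabs x * (Rabs x / 2)) by field.
  apply Rmult_le_compat_l; [apply Rmult_le_pos; lra | easy].
Qed.

(** The numerator is at most [2 M x^2], since [g] is [O(x^2)] and [dg] is [O(x)], and the
    denominator is at least [x^2 / 4]. *)
Let dh_bound x : Rabs x <= 8 / 5 -> Rabs (dh x) <= 8 * M.
Proof.
intros Hx; unfold dh.
destruct (Req_dec x 0) as [-> | H0].
- rewrite g0, dg0; unfold Rdiv; rewrite !Rmult_0_l, Rminus_0_r, Rmult_0_l, Rabs_R0; lra.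
- destruct (g_bound x ltac:(lra)) as [B1 B2]; pose proof (Rabs_sin_ge_half x Hx) as S.
  assert (0 < Rabs x) by now apply Rabs_pos_lt.
  assert (S2 : Rabs x ^ 2 / 4 <= Rabs (sin x) ^ 2) by nra.
  assert (0 < Rabs x ^ 2) by (apply pow_lt; easy).
  unfold Rdiv; rewrite Rabs_mult, Rabs_inv, <- RPow_abs.
  apply (Rmult_le_reg_r (Rabs (sin x) ^ 2)); [lra |].
  rewrite Rmult_assoc, Rinv_l, Rmult_1_r by lra.
  apply Rle_trans with (8 * M * (Rabs x ^ 2 / 4)).
  2: apply Rmult_le_compat_l; lra.
  eapply Rle_trans; [apply Rabs_triang |]; rewrite Rabs_Ropp, !Rabs_mult.
  replace (8 * M * (Rabs x ^ 2 / 4)) with (M * Rabs x * Rabs x + M * Rabs x ^ 2 * 1) by field.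
  apply Rplus_le_compat; apply Rmult_le_compat; try apply Rabs_pos; try easy.
  + apply Rabs_sin_le.
  + apply Rabs_le; pose proof (COS_bound x); lra.
Qed.

Let N := 2 * INR n.
Let N_pos : 0 < N.
Proof. unfold N; apply lt_0_INR in Hn; lra. Qed.
(** Integration by parts in differential form: where [sin x] is nonzero, [E' = g D = h sin (N x)],
    which the derivative of the cosine cancels. What is left of [F'] is [dh cos (N x) / N], of order
    [1/N]. *)
Let F x := E x + h x * cos (N * x) / N.

Let h_continuous_0 : continuity_pt h 0.
Proof.
intros eps Heps.
assert (HK : 0 < 2 * M + 1) by lra.
exists (Rmin (8 / 5) (eps / (2 * M + 1))); split.
- apply Rmin_pos; [lra | apply Rdiv_lt_0_compat; easy].
- intros x [_ Hx]; simpl in *; unfold Rdist in *.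
  assert (h 0 = 0) as -> by (unfold h; rewrite g0; unfold Rdiv; ring).
  rewrite Rminus_0_r in *.
  pose proof (Rmin_l (8 / 5) (eps / (2 * M + 1))); pose proof (Rmin_r (8 / 5) (eps / (2 * M + 1))).
  eapply Rle_lt_trans; [apply h_bound; lra |].
  apply Rle_lt_trans with ((2 * M + 1) * Rabs x).
  + apply Rmult_le_compat_r; [apply Rabs_pos | lra].
  + replace eps with ((2 * M + 1) * (eps / (2 * M + 1))) by (field; lra).
    apply Rmult_lt_compat_l; lra.
Qed.

Let h_derive x : 0 < x <= PI / 2 -> is_derive h x (dh x).
Proof.
intros Hx; pose proof half_PI_lt.
assert (0 < sin x) by (apply sin_gt_0; lra).
apply (is_derive_div g sin); [apply Hg; rewrite Rabs_pos_eq; lra | | lra].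
apply is_derive_Reals, derivable_pt_lim_sin.
Qed.

Let F_derive x : 0 < x <= PI / 2 -> is_derive F x (dh x * cos (N * x) / N).
Proof.
intros Hx; pose proof half_PI_lt.
assert (0 < sin x) by (apply sin_gt_0; lra).
replace (dh x * cos (N * x) / N)
  with (g x * D x + (dh x * (cos (N * x) / N) + h x * (- sin (N * x)))).
2:{ unfold h; unfold N at 3; rewrite <- HD; field; lra. }
apply (is_derive_plus (V := R_NormedModule)); [apply HE |].
apply (is_derive_ext (fun x => h x * (cos (N * x) / N))); [intros t; simpl; unfold Rdiv; ring |].
apply (is_derive_mult h (fun x => cos (N * x) / N)); [now apply h_derive | | intros; apply Rmult_comm].
auto_derive; [easy | field; lra].
Qed.

(** The mean value of [F'] over the interval contributes at most [(8/5) 8 M / N] and the boundary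
    term [4 M / N]; [32 M / N] is a loose cover. Only the decay in [n] matters. *)
Lemma dirichlet_kernel_bound : Rabs (E (PI / 2)) <= 16 * M / INR n.
Proof.
destruct half_PI_lt as [P1 P2].
destruct (MVT_gen F 0 (PI / 2) (fun x => dh x * cos (N * x) / N)) as [x [Hx HF]].
- rewrite Rmin_left, Rmax_right by lra; intros x Hx; apply F_derive; lra.
- rewrite Rmin_left, Rmax_right by lra; intros x Hx.
  (* At the endpoint 0 the mean value theorem asks only for continuity of [F]. *)
  destruct (Req_dec x 0) as [-> | H0].
  + unfold F; apply continuity_pt_plus.
    * apply derivable_continuous_pt; exists (g 0 * D 0); apply is_derive_Reals, HE.
    * unfold Rdiv; apply continuity_pt_mult; [apply continuity_pt_mult; [exact h_continuous_0 |] |].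
      -- apply derivable_continuous_pt; reg.
      -- apply continuity_pt_const; intros ? ?; reflexivity.
  + apply derivable_continuous_pt; eexists; apply is_derive_Reals, F_derive; lra.
- rewrite Rmin_left, Rmax_right in Hx by lra.
  assert (C1 : forall y, Rabs (cos y) <= 1) by (intros y; apply Rabs_le; pose proof (COS_bound y); lra).
  assert (F0 : F 0 = 0) by (unfold F, h; rewrite E0, g0; unfold Rdiv; ring).
  assert (HE2 : E (PI / 2) = (dh x * cos (N * x)) / N * (PI / 2) - h (PI / 2) * cos (N * (PI / 2)) / N).
  { rewrite F0 in HF; unfold F in HF; lra. }
  assert (Hx' : Rabs x <= 8 / 5) by (rewrite Rabs_pos_eq; lra).
  assert (HP : Rabs (PI / 2) <= 8 / 5) by (rewrite Rabs_pos_eq; lra).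
  pose proof (dh_bound x Hx') as B1; pose proof (h_bound _ HP) as B2.
  rewrite (Rabs_pos_eq (PI / 2)) in B2 by lra.
  assert (B3 : Rabs (dh x * cos (N * x)) <= 8 * M).
  { rewrite Rabs_mult, <- (Rmult_1_r (8 * M)); apply Rmult_le_compat; auto using Rabs_pos. }
  assert (B4 : Rabs (h (PI / 2) * cos (N * (PI / 2))) <= 4 * M).
  { rewrite Rabs_mult, <- (Rmult_1_r (4 * M)); apply Rmult_le_compat; auto using Rabs_pos.
    eapply Rle_trans; [exact B2 | nra]. }
  replace (16 * M / INR n) with (32 * M / N).
  2:{ unfold N; apply lt_0_INR in Hn; field; lra. }
  rewrite HE2; change (32 * M / N) with (32 * M * / N).
  replace (dh x * cos (N * x) / N * (PI / 2) - h (PI / 2) * cos (N * (PI / 2)) / N)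
    with ((dh x * cos (N * x) * (PI / 2) + - (h (PI / 2) * cos (N * (PI / 2)))) * / N)
    by (unfold Rdiv; ring).
  assert (0 < / N) by now apply Rinv_0_lt_compat.
  rewrite Rabs_mult, (Rabs_pos_eq (/ N)) by lra.
  apply Rmult_le_compat_r; [lra |].
  eapply Rle_trans; [apply Rabs_triang |]; rewrite Rabs_Ropp, Rabs_mult, (Rabs_pos_eq (PI / 2)) by lra.
  nra.
Qed.

End DirichletKernel.

(** Given by coordinates, so that real differentiation applies to each of them; [Ccos_parts] brings
    [Ccos] to the same form. *)
Definition Csin (z : C) : C := (sin (fst z) * cosh (snd z), cos (fst z) * sinh (snd z)).

Lemma Ccos_parts (z : C) :
  Ccos z = (cos (fst z) * cosh (snd z), - (sin (fst z) * sinh (snd z))).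
Proof.
destruct z as [u v]; unfold Ccos, Cexp, Cdiv, Cinv, Cmul, Cadd, Copp, Ci, RtoC, cosh, sinh; simpl.
unfold Defs.Cdiv, Defs.Cinv, Defs.Cmul, Defs.Cadd, Defs.Copp, Defs.Ci, Defs.RtoC; simpl.
replace (0 * u - 1 * v) with (- v) by ring; replace (0 * v + 1 * u) with u by ring.
rewrite Ropp_involutive, cos_neg, sin_neg; f_equal; field.
Qed.

Lemma is_derive_Csin_div (w : C) (x : R) :
  w <> 0 ->
  is_derive (fun x => fst (Csin (w * RtoC x) / w)%C) x (fst (Ccos (w * RtoC x)%C)) /\
  is_derive (fun x => snd (Csin (w * RtoC x) / w)%C) x (snd (Ccos (w * RtoC x)%C)).
Proof.
intros Hw; rewrite Ccos_parts; destruct w as [r s].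
assert (Hd : r ^ 2 + s ^ 2 <> 0).
{ intros H; apply Hw; unfold RtoC; f_equal; nra. }
unfold Csin, Cdiv, Cinv, Cmult, RtoC, cosh, sinh; simpl; simpl in Hd.
split; auto_derive; try easy; unfold Rminus; field;
  intros H; apply Hd; rewrite <- H; ring.
Qed.

(** Same shape as in [PI_tg], so that the terms of Leibniz's series agree by conversion. *)
Definition odd_num (k : nat) : R := INR (2 * k + 1).

Lemma odd_eq (k : nat) : odd_num k = 2 * INR k + 1.
Proof. unfold odd_num; now rewrite plus_INR, mult_INR. Qed.

Fixpoint odd_cos_sum (n : nat) (x : R) : R :=
  match n with O => 0 | S m => odd_cos_sum m x + 2 * cos (odd_num m * x) end.

Lemma odd_cos_sum_sin (n : nat) (x : R) : odd_cos_sum n x * sin x = sin (2 * INR n * x).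
Proof.
induction n as [|n IH].
- simpl; replace (2 * 0 * x) with 0 by ring; rewrite sin_0; ring.
- simpl odd_cos_sum; rewrite Rmult_plus_distr_r, IH.
  rewrite S_INR, odd_eq.
  replace (2 * (INR n + 1) * x) with (2 * INR n * x + x + x) by ring.
  replace ((2 * INR n + 1) * x) with (2 * INR n * x + x) by ring.
  set (t := 2 * INR n * x).
  rewrite !sin_plus, !cos_plus.
  pose proof (sin2_cos2 x) as H; unfold Rsqr in H.
  (* With this homogeneous form, [2 cos (t+x) sin x = sin (t+2x) - sin t] is a polynomial
     identity. *)
  replace (sin t) with (sin t * (sin x * sin x + cos x * cos x)) at 1 by (rewrite H; ring).
  ring.
Qed.

(* The [x]-derivative of this sum is [(cos (d x) - 1)] times the Dirichlet kernel
   [2 cos x + 2 cos 3x + ... + 2 cos (2n-1)x = sin 2nx / sin x]. *)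
Definition secant_remainder (d : C) (n : nat) (x : R) : C :=
  Cpartial (fun k => Csin ((odd_num k + d) * x) / (odd_num k + d) + Csin ((odd_num k - d) * x) / (odd_num k - d)
                     - 2 * (Csin (odd_num k * x) / odd_num k))%C n.

Lemma odd_neq_0 (k : nat) : RtoC (odd_num k) <> 0.
Proof.
intros H; apply RtoC_inj in H; unfold odd_num in H; revert H; apply not_0_INR; lia.
Qed.

(** Termwise, [cos ((m+d)x) + cos ((m-d)x) - 2 cos (m x) = 2 cos (m x) (cos (d x) - 1)]; the two
    statements are its real and imaginary parts. *)
Lemma secant_remainder_derive (d : C) (n : nat) (x : R) :
  (forall k, (odd_num k + d)%C <> 0) -> (forall k, (odd_num k - d)%C <> 0) ->
  is_derive (fun x => fst (secant_remainder d n x)) x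
    ((cos (fst d * x) * cosh (snd d * x) - 1) * odd_cos_sum n x) /\
  is_derive (fun x => snd (secant_remainder d n x)) x
    (- (sin (fst d * x) * sinh (snd d * x)) * odd_cos_sum n x).
Proof.
intros H1 H2; induction n as [|n [IH1 IH2]].
- simpl; rewrite !Rmult_0_r; split; apply (is_derive_const (V := R_NormedModule)).
- destruct (is_derive_Csin_div _ x (H1 n)) as [A1 A2].
  destruct (is_derive_Csin_div _ x (H2 n)) as [B1 B2].
  destruct (is_derive_Csin_div _ x (odd_neq_0 n)) as [C1 C2].
  rewrite Ccos_parts in A1, A2, B1, B2, C1, C2.
  simpl odd_cos_sum; rewrite !Rmult_plus_distr_l.
  destruct d as [p q].
  split.
  + apply (is_derive_plus (V := R_NormedModule)) with (1 := IH1).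
    apply (is_derive_ext (K := R_AbsRing) (V := R_NormedModule) (fun x : R => fst (Csin ((odd_num n + (p, q)) * x) / (odd_num n + (p, q)))%C
      + fst (Csin ((odd_num n - (p, q)) * x) / (odd_num n - (p, q)))%C
      - 2 * fst (Csin (odd_num n * x) / odd_num n)%C)).
    { intros t; simpl; ring. }
    match goal with |- is_derive _ _ ?l => match type of A1 with is_derive _ _ ?a =>
      match type of B1 with is_derive _ _ ?b => match type of C1 with is_derive _ _ ?c =>
        replace l with (a + b - 2 * c) end end end end.
    * apply (is_derive_minus (V := R_NormedModule)); [apply (is_derive_plus (V := R_NormedModule)) |];
        [exact A1 | exact B1 | apply is_derive_scal; exact C1].
    * simpl fst; simpl snd.
      replace ((odd_num n + p) * x - (0 + q) * 0) with (odd_num n * x + p * x) by ring.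
      replace ((odd_num n + p) * 0 + (0 + q) * x) with (q * x) by ring.
      replace ((odd_num n + - p) * x - (0 + - q) * 0) with (odd_num n * x - p * x) by ring.
      replace ((odd_num n + - p) * 0 + (0 + - q) * x) with (- (q * x)) by ring.
      replace (odd_num n * x - 0 * 0) with (odd_num n * x) by ring.
      replace (odd_num n * 0 + 0 * x) with 0 by ring.
      rewrite cos_plus, cos_minus, cosh_0; unfold cosh; rewrite Ropp_involutive; field.
  + apply (is_derive_plus (V := R_NormedModule)) with (1 := IH2).
    apply (is_derive_ext (K := R_AbsRing) (V := R_NormedModule) (fun x : R => snd (Csin ((odd_num n + (p, q)) * x) / (odd_num n + (p, q)))%C
      + snd (Csin ((odd_num n - (p, q)) * x) / (odd_num n - (p, q)))%C
      - 2 * snd (Csin (odd_num n * x) / odd_num n)%C)).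
    { intros t; simpl; ring. }
    match goal with |- is_derive _ _ ?l => match type of A2 with is_derive _ _ ?a =>
      match type of B2 with is_derive _ _ ?b => match type of C2 with is_derive _ _ ?c =>
        replace l with (a + b - 2 * c) end end end end.
    * apply (is_derive_minus (V := R_NormedModule)); [apply (is_derive_plus (V := R_NormedModule)) |];
        [exact A2 | exact B2 | apply is_derive_scal; exact C2].
    * simpl fst; simpl snd.
      replace ((odd_num n + p) * x - (0 + q) * 0) with (odd_num n * x + p * x) by ring.
      replace ((odd_num n + p) * 0 + (0 + q) * x) with (q * x) by ring.
      replace ((odd_num n + - p) * x - (0 + - q) * 0) with (odd_num n * x - p * x) by ring.
      replace ((odd_num n + - p) * 0 + (0 + - q) * x) with (- (q * x)) by ring.
      replace (odd_num n * x - 0 * 0) with (odd_num n * x) by ring.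
      replace (odd_num n * 0 + 0 * x) with 0 by ring.
      rewrite sin_plus, sin_minus, sinh_0; unfold sinh; rewrite Ropp_involutive; field.
Qed.

Lemma secant_remainder_0 (d : C) (n : nat) : secant_remainder d n 0 = RtoC 0.
Proof.
assert (Z : forall z w : C, (Csin (z * RtoC 0) / w)%C = RtoC 0).
{ intros z w; replace (z * RtoC 0)%C with (RtoC 0) by ring.
  unfold Csin, RtoC; simpl; rewrite sin_0, sinh_0, Rmult_0_l, Rmult_0_r.
  change (RtoC 0 / w = RtoC 0)%C; unfold Cdiv; ring. }
induction n as [|n IH]; [reflexivity |].
change (secant_remainder d n 0
  + (Csin ((odd_num n + d) * RtoC 0) / (odd_num n + d) + Csin ((odd_num n - d) * RtoC 0) / (odd_num n - d)
                     - 2 * (Csin (odd_num n * RtoC 0) / odd_num n)) = RtoC 0)%C.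
rewrite IH, !Z; ring.
Qed.

Lemma continuous_bounded (f : R -> R) : (forall t, continuity_pt f t) ->
  exists M, forall t, Rabs t <= 2 -> Rabs (f t) <= M.
Proof.
intros Hf.
destruct (continuity_ab_maj (fun t => Rabs (f t)) (-2) 2) as [t0 [H0 _]]; [lra | |].
- intros t _; apply (continuity_pt_comp f Rabs); [apply Hf | apply Rcontinuity_abs].
- exists (Rabs (f t0)); intros t Ht; apply H0; apply Rabs_le_between; exact Ht.
Qed.

(** [g1] and [g2] are the coordinates of [cos (d x) - 1]. Both vanish to second order at 0, and
    their second derivatives are bounded on [[-2, 2]] by compactness, independently of [n]. *)
Lemma secant_remainder_cv (d : C) :
  (forall k, (odd_num k + d)%C <> 0) -> (forall k, (odd_num k - d)%C <> 0) ->
  Cseq_cv (fun n => secant_remainder d n (PI / 2)) (RtoC 0).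
Proof.
intros H1 H2; destruct d as [p q].
set (g1 x := cos (p * x) * cosh (q * x) - 1).
set (dg1 x := - p * sin (p * x) * cosh (q * x) + q * cos (p * x) * sinh (q * x)).
set (ddg1 x := (q ^ 2 - p ^ 2) * (cos (p * x) * cosh (q * x)) - 2 * p * q * (sin (p * x) * sinh (q * x))).
set (g2 x := - (sin (p * x) * sinh (q * x))).
set (dg2 x := - p * cos (p * x) * sinh (q * x) - q * sin (p * x) * cosh (q * x)).
set (ddg2 x := (p ^ 2 - q ^ 2) * (sin (p * x) * sinh (q * x)) - 2 * p * q * (cos (p * x) * cosh (q * x))).
destruct (continuous_bounded ddg1) as [M1 HM1].
{ intros t; unfold ddg1; apply derivable_continuous_pt, ex_derive_Reals_0.
  unfold cosh, sinh; auto_derive; easy. }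
destruct (continuous_bounded ddg2) as [M2 HM2].
{ intros t; unfold ddg2; apply derivable_continuous_pt, ex_derive_Reals_0.
  unfold cosh, sinh; auto_derive; easy. }
apply Cseq_cv_of_shift.
apply (Cseq_cv_squeeze _ _ (fun n => (16 * M1 + 16 * M2) * / INR (S n))).
- intros n; replace (secant_remainder (p, q) (S n) (PI / 2) - 0)%C
    with (secant_remainder (p, q) (S n) (PI / 2)) by ring.
  eapply Rle_trans; [apply Cmod_le_abs |]; rewrite Rmult_plus_distr_r; apply Rplus_le_compat.
  + apply (dirichlet_kernel_bound g1 dg1 ddg1 M1 (S n) (odd_cos_sum (S n))
      (fun x => fst (secant_remainder (p, q) (S n) x))).
    * lia.
    * intros t _; unfold g1, dg1, cosh, sinh; auto_derive; [easy | field].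
    * intros t _; unfold dg1, ddg1, cosh, sinh; auto_derive; [easy | field].
    * exact HM1.
    * unfold g1; rewrite !Rmult_0_r, cos_0, cosh_0; ring.
    * unfold dg1; rewrite !Rmult_0_r, sin_0, sinh_0; ring.
    * intros x; apply odd_cos_sum_sin.
    * intros x; exact (proj1 (secant_remainder_derive (p, q) (S n) x H1 H2)).
    * now rewrite secant_remainder_0.
  + apply (dirichlet_kernel_bound g2 dg2 ddg2 M2 (S n) (odd_cos_sum (S n))
      (fun x => snd (secant_remainder (p, q) (S n) x))).
    * lia.
    * intros t _; unfold g2, dg2, cosh, sinh; auto_derive; [easy | field].
    * intros t _; unfold dg2, ddg2, cosh, sinh; auto_derive; [easy | field].
    * exact HM2.
    * unfold g2; rewrite !Rmult_0_r, sin_0, sinh_0; ring.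
    * unfold dg2; rewrite !Rmult_0_r, sin_0, sinh_0; ring.
    * intros x; apply odd_cos_sum_sin.
    * intros x; exact (proj2 (secant_remainder_derive (p, q) (S n) x H1 H2)).
    * now rewrite secant_remainder_0.
- replace (Finite 0) with (Rbar_mult (16 * M1 + 16 * M2) 0) by (simpl; f_equal; ring).
  apply is_lim_seq_scal_l.
  apply (is_lim_seq_incr_1 (fun n => / INR n)).
  replace (Finite 0) with (Rbar_inv p_infty) by reflexivity.
  apply is_lim_seq_inv; [apply is_lim_seq_INR | easy].
Qed.

Lemma sin_cos_odd_half_PI (k : nat) :
  sin (odd_num k * (PI / 2)) = (-1) ^ k /\ cos (odd_num k * (PI / 2)) = 0.
Proof.
induction k as [|k [IH1 IH2]].
- unfold odd_num; simpl; rewrite Rmult_1_l, sin_PI2, cos_PI2; easy.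
- replace (odd_num (S k) * (PI / 2)) with (odd_num k * (PI / 2) + PI)
    by (rewrite !odd_eq, S_INR; field).
  rewrite neg_sin, neg_cos, IH1, IH2; simpl; split; ring.
Qed.

Lemma Csin_odd_half_PI (k : nat) (z : C) :
  Csin (RtoC (odd_num k * (PI / 2)) + z)%C = (RtoC ((-1) ^ k) * Ccos z)%C.
Proof.
destruct (sin_cos_odd_half_PI k) as [Hs Hc].
rewrite Ccos_parts; destruct z as [u v]; unfold Csin, RtoC, Cplus, Cmult; simpl fst; simpl snd.
rewrite sin_plus, cos_plus, Hs, Hc, Rplus_0_l; f_equal; ring.
Qed.

Lemma Ccos_neg (z : C) : Ccos (- z)%C = Ccos z.
Proof.
rewrite !Ccos_parts; destruct z as [u v]; simpl.
rewrite cos_neg, sin_neg; unfold cosh, sinh; rewrite Ropp_involutive; f_equal; field.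
Qed.

Lemma Leibniz_series : Cseq_cv (Cpartial (fun k => RtoC ((-1) ^ k / odd_num k))) (RtoC (PI / 4)).
Proof.
apply Cseq_cv_of_shift.
apply (Cseq_cv_ext (fun n => RtoC (sum_f_R0 (tg_alt PI_tg) n))).
- intros n; induction n as [|n IH].
  + simpl; unfold tg_alt, PI_tg, odd_num; change (RtoC (1 * / INR 1) = RtoC 0 + RtoC (1 / INR 1))%C.
    rewrite <- RtoC_plus; f_equal; simpl; field.
  + rewrite tech5, RtoC_plus, IH; reflexivity.
- apply Cseq_cv_RtoC, is_lim_seq_Reals.
  rewrite <- Alt_PI_eq; unfold Alt_PI; destruct exist_PI as [l Hl].
  replace (4 * l / 4) with l by field; exact Hl.
Qed.

(** At [x = PI / 2] and [d = 2 c], each sine in the remainder becomes [(-1)^k cos (PI c)], or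
    [(-1)^k] for the Leibniz part. Twice the remainder plus four times Leibniz's sum is therefore
    exactly the partial sum in question, with limit [4 * PI / 4]. *)
Lemma secant_series (c : C) :
  (forall k : nat, (1 / 2 + c + INR k)%C <> 0) -> (forall k : nat, (1 / 2 - c + INR k)%C <> 0) ->
  Cseq_cv (fun n => Ccos (PI * c) *
    Cpartial (fun k => RtoC ((-1) ^ k) / (INR k + (1 / 2 + c)) + RtoC ((-1) ^ k) / (INR k + (1 / 2 - c))) n)%C
    (RtoC PI).
Proof.
intros H1 H2.
assert (O : forall k, RtoC (odd_num k) = (2 * (INR k + 1 / 2))%C).
{ intros k; rewrite odd_eq, RtoC_plus, RtoC_mult; field. }
assert (N2 : RtoC 2 <> RtoC 0) by (intros H; apply RtoC_inj in H; lra).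
assert (P1 : forall k, (odd_num k + 2 * c)%C <> 0).
{ intros k; rewrite O; replace (2 * (INR k + 1 / 2) + 2 * c)%C with (2 * (1 / 2 + c + INR k))%C by ring.
  now apply Cmult_neq_0. }
assert (P2 : forall k, (odd_num k - 2 * c)%C <> 0).
{ intros k; rewrite O; replace (2 * (INR k + 1 / 2) - 2 * c)%C with (2 * (1 / 2 - c + INR k))%C by ring.
  now apply Cmult_neq_0. }
pose proof (secant_remainder_cv (2 * c)%C P1 P2) as L.
assert (EPI : RtoC PI = (2 * (0 + 2 * RtoC (PI / 4)))%C).
{ rewrite <- !RtoC_mult, <- RtoC_plus, <- RtoC_mult; f_equal; field. }
refine (eq_ind_r (Cseq_cv _) _ EPI); eapply Cseq_cv_ext; [| apply Cseq_cv_scal, Cseq_cv_plus; [exact L | apply Cseq_cv_scal, Leibniz_series]].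
intros n; cbv beta.
induction n as [|n IH].
- change (2 * (RtoC 0 + 2 * RtoC 0) = Ccos (PI * c) * RtoC 0)%C; ring.
- set (f k := (RtoC ((-1) ^ k) / (INR k + (1 / 2 + c)) + RtoC ((-1) ^ k) / (INR k + (1 / 2 - c)))%C) in *.
  change (Cpartial f (S n)) with (Cpartial f n + f n)%C.
  rewrite (Cmult_plus_distr_l (Ccos (PI * c)%C)), <- IH.
  set (r := secant_remainder (2 * c)%C n (PI / 2)).
  set (g k := RtoC ((-1) ^ k / odd_num k)).
  change (2 * (r + (Csin ((odd_num n + 2 * c) * RtoC (PI / 2)) / (odd_num n + 2 * c)
                    + Csin ((odd_num n - 2 * c) * RtoC (PI / 2)) / (odd_num n - 2 * c)
                    - 2 * (Csin (odd_num n * RtoC (PI / 2)) / odd_num n)) + 2 * (Cpartial g n + g n))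
          = 2 * (r + 2 * Cpartial g n) + Ccos (PI * c) * f n)%C.
  unfold g at 2.
  replace ((odd_num n + 2 * c) * RtoC (PI / 2))%C with (RtoC (odd_num n * (PI / 2)) + PI * c)%C
    by (rewrite RtoC_mult, RtoC_div by lra; field; exact N2).
  replace ((odd_num n - 2 * c) * RtoC (PI / 2))%C with (RtoC (odd_num n * (PI / 2)) + - (PI * c))%C
    by (rewrite RtoC_mult, RtoC_div by lra; field; exact N2).
  replace (odd_num n * RtoC (PI / 2))%C with (RtoC (odd_num n * (PI / 2)) + 0)%C by (rewrite RtoC_mult; ring).
  rewrite !Csin_odd_half_PI, Ccos_neg.
  assert (C0 : Ccos (RtoC 0) = RtoC 1).
  { rewrite Ccos_parts; simpl; rewrite cos_0, sin_0, cosh_0; unfold RtoC; f_equal; ring. }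
  rewrite C0, RtoC_div by (apply not_0_INR; lia).
  unfold f; pose proof (odd_neq_0 n) as On; pose proof (P1 n); pose proof (P2 n).
  rewrite O in *.
  field; repeat split; intros E; [apply H0 | apply H | apply On]; rewrite <- E; field.
Qed.

(** * The beta function and the hypergeometric series *)

Definition beta_term (x : C) (k : nat) : C := (RtoC ((-1) ^ k) / (INR k + x))%C.

Lemma beta_term_cv_0 (x : C) : (forall k : nat, (x + INR k)%C <> 0) -> Cseq_cv (beta_term x) (RtoC 0).
Proof.
intros Hx; destruct (nonpole_bound x Hx) as [m [Hm B]].
apply (Cseq_cv_squeeze _ _ (fun n => / m * / INR (S n))).
- intros n; unfold beta_term.
  replace (RtoC ((-1) ^ n) / (INR n + x) - 0)%C with (RtoC ((-1) ^ n) / (x + INR n))%C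
    by (rewrite (Cplus_comm x); unfold Cdiv; ring).
  rewrite Cmod_div by apply Hx.
  rewrite Cmod_R, pow_1_abs, <- Rinv_mult, S_INR; unfold Rdiv; rewrite Rmult_1_l.
  apply Rinv_le_contravar; [| apply B].
  pose proof (pos_INR n); apply Rmult_lt_0_compat; lra.
- replace (Finite 0) with (Rbar_mult (/ m) 0) by (simpl; f_equal; ring).
  apply is_lim_seq_scal_l.
  apply (is_lim_seq_incr_1 (fun n => / INR n)).
  replace (Finite 0) with (Rbar_inv p_infty) by reflexivity.
  apply is_lim_seq_inv; [apply is_lim_seq_INR | easy].
Qed.

Lemma RtoC_2_neq_0 : RtoC 2 <> 0.
Proof. intros H; apply RtoC_inj in H; lra. Qed.

(** The terms [2k] and [2k + 1] together give half the difference of the digamma terms at [(x+1)/2]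
    and [x/2]; the logarithms cancel between the two. *)
Lemma beta_Psi_cv (x : C) :
  (forall k : nat, (x + INR k)%C <> 0) ->
  Cseq_cv (Cpartial (beta_term x)) ((Psi ((x + 1) / 2)%C - Psi (x / 2)%C) / 2)%C.
Proof.
intros Hx; pose proof RtoC_2_neq_0 as H2.
assert (I : forall k, RtoC (INR (2 * k)) = (2 * INR k)%C) by (intros k; now rewrite mult_INR, RtoC_mult).
assert (I' : forall k, RtoC (INR (2 * k + 1)) = (2 * INR k + 1)%C)
  by (intros k; now rewrite plus_INR, RtoC_plus, I).
assert (X0 : forall k : nat, (x / 2 + INR k)%C <> 0).
{ intros k E; apply (Hx (2 * k)%nat).
  replace (x + INR (2 * k)%nat)%C with (2 * (x / 2 + INR k))%C by (rewrite I; field).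
  rewrite E; ring. }
assert (X1 : forall k : nat, ((x + 1) / 2 + INR k)%C <> 0).
{ intros k E; apply (Hx (2 * k + 1)%nat).
  replace (x + INR (2 * k + 1)%nat)%C with (2 * ((x + 1) / 2 + INR k))%C by (rewrite I'; field).
  rewrite E; ring. }
apply Cseq_cv_even.
- apply (Cseq_cv_ext (fun n => / 2 * (Cpartial (digamma_term ((x + 1) / 2)) n
                                        - Cpartial (digamma_term (x / 2)) n))%C).
  + induction n as [|n IH].
    * change (/ 2 * (RtoC 0 - RtoC 0) = RtoC 0)%C; ring.
    * replace (2 * S n)%nat with (S (S (2 * n))) by lia.
      change (/ 2 * ((Cpartial (digamma_term ((x + 1) / 2)) n + digamma_term ((x + 1) / 2) n)
                     - (Cpartial (digamma_term (x / 2)) n + digamma_term (x / 2) n))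
              = Cpartial (beta_term x) (2 * n) + beta_term x (2 * n) + beta_term x (S (2 * n)))%C.
      rewrite <- IH; unfold beta_term, digamma_term.
      rewrite pow_1_even, pow_1_odd.
      replace (S (2 * n)) with (2 * n + 1)%nat by lia.
      pose proof (Hx (2 * n)%nat) as Y0; pose proof (Hx (2 * n + 1)%nat) as Y1.
      rewrite I in *; rewrite I' in *.
      specialize (X0 n); specialize (X1 n).
      field; repeat split; intros E; [apply Y1 | apply Y0]; rewrite <- E; ring.
  + replace ((Psi ((x + 1) / 2) - Psi (x / 2)) / 2)%C with (/ 2 * (Psi ((x + 1) / 2) - Psi (x / 2)))%C
      by field.
    apply Cseq_cv_scal, Cseq_cv_minus; now apply Psi_cv.
- apply (Cseq_cv_ext (beta_term x)); [| now apply beta_term_cv_0].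
  intros n; change (beta_term x n = Cpartial (beta_term x) n + beta_term x n - Cpartial (beta_term x) n)%C.
  ring.
Qed.

Lemma beta_fun_Psi (x : C) :
  (forall k : nat, (x + INR k)%C <> 0) ->
  beta_fun x = ((Psi ((x + 1) / 2)%C - Psi (x / 2)%C) / 2)%C.
Proof. intros Hx; apply Clim_seq_eq, beta_Psi_cv, Hx. Qed.

Lemma beta_fun_cv (x : C) :
  (forall k : nat, (x + INR k)%C <> 0) -> Cseq_cv (Cpartial (beta_term x)) (beta_fun x).
Proof. intros Hx; rewrite beta_fun_Psi by easy; now apply beta_Psi_cv. Qed.

Lemma Cpartial_plus (f g : nat -> C) (n : nat) :
  Cpartial (fun k => f k + g k)%C n = (Cpartial f n + Cpartial g n)%C.
Proof.
induction n as [|n IH].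
- change (RtoC 0 = RtoC 0 + RtoC 0)%C; ring.
- change (Cpartial (fun k => f k + g k)%C n + (f n + g n)
    = (Cpartial f n + f n) + (Cpartial g n + g n))%C.
  rewrite IH; ring.
Qed.

Lemma beta_reflection (c : C) :
  (forall k : nat, (1 / 2 + c + INR k)%C <> 0) -> (forall k : nat, (1 / 2 - c + INR k)%C <> 0) ->
  (Ccos (PI * c)%C * (beta_fun (1 / 2 + c)%C + beta_fun (1 / 2 - c)%C))%C = RtoC PI.
Proof.
intros H1 H2; eapply Cseq_cv_unique; [| exact (secant_series c H1 H2)].
apply Cseq_cv_scal.
apply (Cseq_cv_ext (fun n => Cpartial (beta_term (1 / 2 + c)) n + Cpartial (beta_term (1 / 2 - c)) n)%C).
- intros n; symmetry; exact (Cpartial_plus (beta_term (1 / 2 + c)%C) (beta_term (1 / 2 - c)%C) n).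
- apply Cseq_cv_plus; now apply beta_fun_cv.
Qed.

(** Both sides are [poch a (S n)], with the first or the last factor split off. *)
Lemma poch_succ (a : C) (n : nat) : (poch (a + 1)%C n * a)%C = (poch a n * (a + INR n))%C.
Proof.
induction n as [|n IH].
- change (RtoC 1 * a = RtoC 1 * (a + RtoC 0))%C; ring.
- change (poch (a + 1)%C n * (a + 1 + INR n) * a = poch a n * (a + INR n) * (a + INR (S n)))%C.
  rewrite <- IH, S_INR, RtoC_plus; ring.
Qed.

Lemma poch_neq_0 (a : C) (n : nat) : (forall k : nat, (a + INR k)%C <> 0) -> poch a n <> RtoC 0.
Proof.
intros Ha; induction n as [|n IH]; [exact C1_nz |].
change ((poch a n * (a + INR n))%C <> 0); now apply Cmult_neq_0.
Qed.

Lemma poch_1 (n : nat) : poch (RtoC 1) n = RtoC (INR (fact n)).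
Proof.
induction n as [|n IH]; [reflexivity |].
change ((poch (RtoC 1) n * (1 + INR n))%C = RtoC (INR (fact (S n)))).
rewrite IH, fact_simpl, mult_INR, S_INR, RtoC_mult, RtoC_plus; ring.
Qed.

Lemma Cpow_RtoC (r : R) (n : nat) : Defs.Cpow (RtoC r) n = RtoC (r ^ n).
Proof.
induction n as [|n IH]; [reflexivity |].
change (RtoC r * Defs.Cpow (RtoC r) n = RtoC (r * r ^ n))%C; now rewrite IH, RtoC_mult.
Qed.

(** [(1)_n] cancels [n!], and [(z)_n / (z+1)_n = z / (z+n)] for both parameters; what remains is
    [y x (-1)^n / ((y+n)(x+n))]. *)
Lemma hyp_term_partial_fractions (y x : C) (n : nat) :
  (forall k : nat, (y + INR k)%C <> 0) -> (forall k : nat, (x + INR k)%C <> 0) -> (x - y)%C <> 0 ->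
  hyp_term [RtoC 1; y; x] [(y + 1)%C; (x + 1)%C] (RtoC (-1)) n
  = (y * x / (x - y) * (beta_term y n - beta_term x n))%C.
Proof.
intros Hy Hx Hd.
assert (S1 : forall z : C, (forall k : nat, (z + INR k)%C <> 0) -> forall k : nat, (z + 1 + INR k)%C <> 0).
{ intros z Hz k; specialize (Hz (S k)); rewrite S_INR, RtoC_plus in Hz.
  intros E; apply Hz; rewrite <- E; ring. }
assert (Z0 : forall z : C, (forall k : nat, (z + INR k)%C <> 0) -> z <> 0).
{ intros z Hz E; apply (Hz 0%nat); rewrite E; simpl; ring. }
assert (Q : forall z : C, (forall k : nat, (z + INR k)%C <> 0) ->
   @eq C (poch z n) (poch (z + 1)%C n * z / (z + INR n))%C).
{ intros z Hz; rewrite poch_succ; generalize (poch z n); intros p; change C in p; field; apply Hz. }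
pose proof (poch_neq_0 (y + 1)%C n (S1 y Hy)) as Py; pose proof (poch_neq_0 (x + 1)%C n (S1 x Hx)) as Px.
assert (Fn : RtoC (INR (fact n)) <> 0) by (intros E; apply RtoC_inj in E; now apply (INR_fact_neq_0 n)).
change (poch (RtoC 1) n * (poch y n * (poch x n * 1)) / (poch (y + 1)%C n * (poch (x + 1)%C n * 1))
   * Defs.Cpow (RtoC (-1)) n / INR (fact n) = y * x / (x - y) * (beta_term y n - beta_term x n))%C.
rewrite poch_1, Cpow_RtoC, (Q y Hy), (Q x Hx); unfold beta_term.
rewrite !(Cplus_comm (INR n)).
pose proof (Hx n); pose proof (Hy n).
field; repeat split; assumption.
Qed.

Lemma pFq_partial_fractions (y x : C) :
  (forall k : nat, (y + INR k)%C <> 0) -> (forall k : nat, (x + INR k)%C <> 0) -> (x - y)%C <> 0 ->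
  pFq [RtoC 1; y; x] [(y + 1)%C; (x + 1)%C] (RtoC (-1)) = (y * x / (x - y) * (beta_fun y - beta_fun x))%C.
Proof.
intros Hy Hx Hd; apply Clim_seq_eq.
apply (Cseq_cv_ext (fun n => y * x / (x - y) * (Cpartial (beta_term y) n - Cpartial (beta_term x) n))%C).
- induction n as [|n IH].
  + change (y * x / (x - y) * (RtoC 0 - RtoC 0) = RtoC 0)%C; ring.
  + change (y * x / (x - y) * ((Cpartial (beta_term y) n + beta_term y n)
        - (Cpartial (beta_term x) n + beta_term x n))
      = Cpartial (hyp_term [RtoC 1; y; x] [y + 1; x + 1] (RtoC (-1))) n
        + hyp_term [RtoC 1; y; x] [y + 1; x + 1] (RtoC (-1)) n)%C.
    rewrite <- IH, hyp_term_partial_fractions by easy; ring.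
- apply Cseq_cv_scal, Cseq_cv_minus; now apply beta_fun_cv.
Qed.

(* The operations of [Defs] are convertible to Coquelicot's homonymous ones, which are used up to here
   for the sake of [ring] and [field]; the statement below refers to those of [Defs]. *)
Import Defs.

Theorem mainTheorem10 (a b : Cplx)
  (ha : a <> Czero)
  (hb : Re b > 0) (hba1 : Re (Cadd b a) > 0) (hba2 : Re (Csub b a) > 0)
  (hp1 : ~ in_Z0minus (Csub (RtoC (3/2)) (Cdiv a (Cmul (RtoC 2) b))))
  (hp2 : ~ in_Z0minus (Cadd (RtoC (3/2)) (Cdiv a (Cmul (RtoC 2) b))))
  (hodd : forall k : nat, Cdiv a b <> RtoC (INR (2 * k + 1)) /\
                          Cdiv a b <> RtoC (- INR (2 * k + 1))) :
  let c := Cdiv a (Cmul (RtoC 2) b) in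
  pFq [Cone; Csub (RtoC (1/2)) c; Cadd (RtoC (1/2)) c]
      [Csub (RtoC (3/2)) c; Cadd (RtoC (3/2)) c] (RtoC (-1))
  = Cmul (Cdiv (Csub (Cmul b b) (Cmul a a)) (Cmul (RtoC 2) (Cmul a b)))
         (Csub (Cmul (RtoC (PI / 2)) (Csec (Cdiv (Cmul (RtoC PI) a) (Cmul (RtoC 2) b))))
               (beta_fun (Cdiv (Cadd a b) (Cmul (RtoC 2) b))))
  /\
  Cmul (Cdiv (Csub (Cmul b b) (Cmul a a)) (Cmul (RtoC 2) (Cmul a b)))
       (Csub (Cmul (RtoC (PI / 2)) (Csec (Cdiv (Cmul (RtoC PI) a) (Cmul (RtoC 2) b))))
             (beta_fun (Cdiv (Cadd a b) (Cmul (RtoC 2) b))))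
  = Cmul (Cdiv (Csub (Cmul b b) (Cmul a a)) (Cmul (RtoC 8) (Cmul a b)))
         (Cadd (Csub (Csub (Psi (Cdiv (Csub (Cmul (RtoC 3) b) a) (Cmul (RtoC 4) b)))
                           (Psi (Cdiv (Csub b a) (Cmul (RtoC 4) b))))
                     (Psi (Cdiv (Cadd (Cmul (RtoC 3) b) a) (Cmul (RtoC 4) b))))
               (Psi (Cdiv (Cadd b a) (Cmul (RtoC 4) b)))).
Proof.
change C in a, b; intros c0.
set (c := (a / (2 * b))%C); change c0 with c; clear c0.
assert (T : forall r, r <> 0 -> Complex.RtoC r <> Complex.RtoC 0) by (intros r Hr E; apply RtoC_inj in E; lra).
pose proof (T 2 ltac:(lra)) as T2; pose proof (T 4 ltac:(lra)) as T4; pose proof (T 8 ltac:(lra)) as T8.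
assert (Hb : b <> Complex.RtoC 0) by (intros E; rewrite E in hb; simpl in hb; lra).
assert (Ha : a <> Complex.RtoC 0) by exact ha.
assert (Half : Complex.RtoC (1 / 2) = (1 / 2)%C) by (apply RtoC_div; lra).
assert (ThreeHalf : Complex.RtoC (3 / 2) = (3 / 2)%C) by (apply RtoC_div; lra).
set (x := (1 / 2 + c)%C); set (y := (1 / 2 - c)%C).
(* A pole [x = -k] means [a/b = -(2k+1)], and [y = -k] means [a/b = 2k+1]: this is where [hodd]
   enters. *)
assert (Hx : forall k : nat, (x + INR k)%C <> 0).
{ intros k E; apply (proj2 (hodd k)).
  change (@eq C (a / b)%C (Complex.RtoC (- INR (2 * k + 1)))).
  rewrite RtoC_opp, plus_INR, mult_INR, RtoC_plus, RtoC_mult; change (INR 2) with 2; change (INR 1) with 1.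
  replace (a / b)%C with (2 * (x + INR k) - (2 * INR k + 1))%C by (unfold x, c; field; easy).
  rewrite E; ring. }
assert (Hy : forall k : nat, (y + INR k)%C <> 0).
{ intros k E; apply (proj1 (hodd k)).
  change (@eq C (a / b)%C (Complex.RtoC (INR (2 * k + 1)))).
  rewrite plus_INR, mult_INR, RtoC_plus, RtoC_mult; change (INR 2) with 2; change (INR 1) with 1.
  replace (a / b)%C with (2 * INR k + 1 - 2 * (y + INR k))%C by (unfold y, c; field; easy).
  rewrite E; ring. }
assert (Hxy : (x - y)%C <> 0).
{ replace (x - y)%C with (a / b)%C by (unfold x, y, c; field; easy).
  intros E; apply Ha; replace a with (a / b * b)%C by (field; easy); rewrite E; ring. }
assert (Hsec : (Complex.RtoC (PI / 2) * Csec (PI * a / (2 * b))%C - beta_fun x)%C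
               = ((beta_fun y - beta_fun x) / 2)%C).
{ replace (PI * a / (2 * b))%C with (PI * c)%C by (unfold c; field; easy).
  pose proof (beta_reflection c Hx Hy) as R; fold x y in R.
  (* The reflection formula itself yields this: its product is [PI], which is nonzero. *)
  assert (Hcos : Ccos (PI * c)%C <> Complex.RtoC 0).
  { intros E; rewrite E, Cmult_0_l in R; apply RtoC_inj in R; pose proof PI_RGT_0; lra. }
  replace (Complex.RtoC (PI / 2)) with (Ccos (PI * c)%C * (beta_fun x + beta_fun y) / 2)%C
    by (rewrite R, RtoC_div by lra; reflexivity).
  change (Csec (PI * c)%C) with (/ Ccos (PI * c)%C)%C.
  revert Hcos; generalize (Ccos (PI * c)%C) (beta_fun y) (beta_fun x).
  intros w u v Hw; change C in w, u, v; field; easy. }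
assert (Hbeta : beta_fun (Cdiv (Cadd a b) (Cmul (RtoC 2) b)) = beta_fun x).
{ f_equal; change (@eq C ((a + b) / (2 * b))%C x); unfold x, c; field; easy. }
rewrite Hbeta; split.
- assert (E1 : Csub (RtoC (1 / 2)) c = y) by (unfold y; now rewrite <- Half).
  assert (E2 : Cadd (RtoC (1 / 2)) c = x) by (unfold x; now rewrite <- Half).
  assert (E3 : Csub (RtoC (3 / 2)) c = (y + 1)%C).
  { change (@eq C (Complex.RtoC (3 / 2) - c)%C (y + 1)%C); rewrite ThreeHalf; unfold y; field; easy. }
  assert (E4 : Cadd (RtoC (3 / 2)) c = (x + 1)%C).
  { change (@eq C (Complex.RtoC (3 / 2) + c)%C (x + 1)%C); rewrite ThreeHalf; unfold x; field; easy. }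
  rewrite E1, E2, E3, E4.
  change Cone with (Complex.RtoC 1); change (RtoC (-1)) with (Complex.RtoC (-1)).
  rewrite pFq_partial_fractions by easy.
  change (@eq C (y * x / (x - y) * (beta_fun y - beta_fun x))%C
    ((b * b - a * a) / (2 * (a * b))
      * (Complex.RtoC (PI / 2) * Csec (PI * a / (2 * b))%C - beta_fun x))%C).
  rewrite Hsec.
  generalize (beta_fun y) (beta_fun x); intros u v; change C in u, v.
  (* Both prefactors become [(b^2 - a^2) / (4ab)], because [x y = (b^2 - a^2) / (4 b^2)]. *)
  replace (x - y)%C with (a / b)%C by (unfold x, y, c; field; easy).
  unfold x, y, c; field; easy.
- change (@eq C ((b * b - a * a) / (2 * (a * b))
      * (Complex.RtoC (PI / 2) * Csec (PI * a / (2 * b))%C - beta_fun x))%C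
    ((b * b - a * a) / (8 * (a * b))
      * (Psi ((3 * b - a) / (4 * b))%C - Psi ((b - a) / (4 * b))%C
         - Psi ((3 * b + a) / (4 * b))%C + Psi ((b + a) / (4 * b))%C))%C).
  rewrite Hsec, (beta_fun_Psi x Hx), (beta_fun_Psi y Hy).
  replace ((3 * b - a) / (4 * b))%C with ((y + 1) / 2)%C by (unfold y, c; field; easy).
  replace ((b - a) / (4 * b))%C with (y / 2)%C by (unfold y, c; field; easy).
  replace ((3 * b + a) / (4 * b))%C with ((x + 1) / 2)%C by (unfold x, c; field; easy).
  replace ((b + a) / (4 * b))%C with (x / 2)%C by (unfold x, c; field; easy).
  generalize (Psi ((y + 1) / 2)%C) (Psi (y / 2)%C) (Psi ((x + 1) / 2)%C) (Psi (x / 2)%C).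
  intros p q r s; change C in p, q, r, s; field; easy.
Qed.
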